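(* Assume that $F:\Omega\times X\to\mathbb{R}^m$ is continuous, of class $C^1$ with respect to the second variable, that $F(\Omega\times X_1)$ is bounded in $\mathbb{R}^m$ for every bounded set $X_1\subset X$, that $$F(\omega,\psi)-F(\omega,\phi)\gg B\,(\psi(0)-\phi(0))\quad\text{whenever } \phi\leq_B\psi,\ \phi\ll\psi \text{ and } \omega\in\Omega,$$ and that $F(\omega,0)\ge0$ for each $\omega\in\Omega$. If there exists an $\omega_0\in\Omega$ such that $F(\omega_0,0)\gg0$, then the skew-product semiflow $\tau$ is uniformly persistent in the interior of the positive cone $\operatorname{Int}\widetilde K_B$.
   Context: $\Omega$ is a compact metric space with a continuous minimal flow $\mathbb{R}\times\Omega\to\Omega$, $(t,\omega)\mapsto\omega\cdot t$. Fix $r>0$, $m\ge 1$. $X=C([-r,0],\mathbb{R}^m)$ with the sup-norm $\|\varphi\|_\infty=\sup_{s\in[-r,0]}\|\varphi(s)\|$, where $\|\cdot\|$ is the maximum norm on $\mathbb{R}^m$. For a continuous $y:[-r,\infty)\to\mathbb{R}^m$ and $t\ge0$, $y_t\in X$ is $y_t(s)=y(t+s)$, $s\in[-r,0]$. For $y\in\mathbb{R}^m$, $y\ge0$ (resp. $y\gg0$) means all components are nonnegative (resp. positive). For $\phi,\psi\in X$: $\phi\le\psi$ means $\psi(s)-\phi(s)\ge 0$ for all $s\in[-r,0]$, and $\phi\ll\psi$ means $\psi(s)-\phi(s)\gg0$ for all $s\in[-r,0]$. $B=[b_{ij}]$ is a fixed real $m\times m$ quasipositive matrix ($b_{ij}\ge0$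 for $i\ne j$). The exponential ordering is given by the cone $K_B=\{\phi\in X\mid \phi\ge0,\ \phi(t)\ge e^{B(t-s)}\phi(s)\text{ for } -r\le s\le t\le0\}$: $\phi\le_B\psi$ iff $\psi-\phi\in K_B$. $X_L\subset X$ is the Banach space of Lipschitz functions with norm $\|\phi\|_L=\|\phi\|_\infty+\sup\{\|\phi(t)-\phi(s)\|/|t-s| : s\ne t\in[-r,0]\}$; $\widetilde K_B=K_B\cap X_L$, whose interior in $X_L$ is $\operatorname{Int}\widetilde K_B=\{\phi\in X_L\mid \phi\gg0 \text{ and, for some }\varepsilon>0,\ \phi'-B\phi\ge(\varepsilon,\dots,\varepsilon)\text{ a.e. on }[-r,0]\}$. We write $\phi\gg_B0$ iff $\phi\in\operatorname{Int}\widetilde K_B$. For $\omega\in\Omega$, $\varphi\in X$, $y(t,\omega,\varphi)$ denotes the unique solution of $y'(t)=F(\omega\cdot t,y_t)$, $t\ge0$, with $y(s,\omega,\varphi)=\varphi(s)$ for $s\in[-r,0]$, and $y_t(\omega,\varphi)\in X$ is $y_t(\omega,\varphi)(s)=y(t+s,\omega,\varphi)$. The induced skew-product semiflow is $\tau(t,\omega,\varphi)=(\omega\cdot t,y_t(\omega,\varphi))$; standing assumption: it is globally defined (all solutions exist for all $t\ge0$). $\tau$ is uniformly persistent in $\operatorname{Int}\widetilde K_B$ if there is a map $\psi\gg_B0$ such that, for every $\omega\in\Omega$ and every $\varphi\gg_B0$, there exists a time $t_0=t_0(\omega,\varphi)$ such that $y_t(\omega,\varphi)\ge_B\psi$ for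 all $t\ge t_0$. *)

(* Defs.v *)
From HB Require Import structures.
From mathcomp Require Import all_boot all_order all_algebra.
From mathcomp Require Import all_classical all_reals all_analysis.

Set Implicit Arguments.
Unset Strict Implicit.
Unset Printing Implicit Defensive.
Import Order.TTheory GRing.Theory Num.Theory.
Import numFieldNormedType.Exports.

Local Open Scope classical_set_scope.
Local Open Scope ring_scope.

(* The space X = C([-r, 0], R^m).  An element is represented by its extension
   by 0 to the whole line, so that equality is equality on [-r, 0] and
   evaluation needs no membership proof. *)
Section hist_def.
Context {R : realType} (r : R) (m : nat).

Definition is_hist (f : R -> 'cV[R]_m) : Prop :=
  {within `[- r, 0], continuous f} /\ (forall t, t \notin `[- r, 0] -> f t = 0).

Definition histp : {pred R -> 'cV[R]_m} := mem [set f | is_hist f].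

Record hist := Hist { hist_fun :> R -> 'cV[R]_m ; _ : hist_fun \in histp }.

HB.instance Definition _ := [isSub for hist_fun].
HB.instance Definition _ := [Choice of hist by <:].

Lemma histP (f : R -> 'cV[R]_m) : reflect (is_hist f) (f \in histp).
Proof. by apply: (iffP idP); rewrite !inE. Qed.

Lemma hist_submod_closed : submod_closed histp.
Proof.
split; first by apply/histP; split => //; exact: cst_continuous.
move=> a f g /histP[cf f0] /histP[cg g0]; apply/histP; split => [|t tr].
  move=> x; apply: (@continuousD _ _ (subspace `[- r, 0])).
    by apply: continuousZl_tmp; exact: cf.
  exact: cg.
by rewrite !fctE f0// g0// scaler0 addr0.
Qed.

HB.instance Definition _ := GRing.isSubmodClosed.Build R (R -> 'cV[R]_m) histp
  hist_submod_closed.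
HB.instance Definition _ := [SubChoice_isSubLmodule of hist by <:].

Definition hist_norm (f : hist) : R := sup [set `|f s| | s in `[- r, 0]].

Lemma hist_norm_has_ubound (f : hist) :
  has_ubound [set `|f s| | s in `[- r, 0]].
Proof.
case: f => f /= /histP[cf _].
have /compact_bounded[M [_ Mf]] :=
  continuous_compact cf (@segment_compact R (- r) 0).
exists (M + 1) => _ [s rs0 <-]; apply: Mf; first by rewrite ltrDl.
by exists s.
Qed.

Lemma hist_norm_ub (f : hist) s : s \in `[- r, 0] -> `|f s| <= hist_norm f.
Proof.
move=> rs0; apply: (ub_le_sup (hist_norm_has_ubound f)).
by exists s.
Qed.

Lemma hist_norm_le (f : hist) (c : R) : 0 <= c ->
  (forall s, s \in `[- r, 0] -> `|f s| <= c) -> hist_norm f <= c.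
Proof.
move=> c0 fc; rewrite /hist_norm.
have [[_ [s rs0 _]]|/nonemptyPn ->] :=
    pselect ([set `|f s| | s in `[- r, 0]] !=set0); last by rewrite sup0.
apply: ge_sup; first by exists `|f s|, s.
by move=> _ [t rt0 <-]; exact: fc.
Qed.

Lemma hist_norm_ge0 (f : hist) : 0 <= hist_norm f.
Proof.
rewrite /hist_norm; have [[_ [s rs0 _]]|/nonemptyPn ->] :=
    pselect ([set `|f s| | s in `[- r, 0]] !=set0); last by rewrite sup0.
exact: le_trans (normr_ge0 _) (hist_norm_ub f rs0).
Qed.

Lemma hist_normD (f g : hist) : hist_norm (f + g) <= hist_norm f + hist_norm g.
Proof.
apply: hist_norm_le => [|s rs0]; first by rewrite addr_ge0 ?hist_norm_ge0.
rewrite (le_trans (ler_normD _ _))//.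
by apply: lerD; exact: hist_norm_ub.
Qed.

Lemma hist_normZ (a : R) (f : hist) : hist_norm (a *: f) = `|a| * hist_norm f.
Proof.
have le_normZ (b : R) (g : hist) : hist_norm (b *: g) <= `|b| * hist_norm g.
  apply: hist_norm_le => [|s rs0]; first by rewrite mulr_ge0 ?hist_norm_ge0.
  rewrite [X in `|X|](_ : _ = b *: g s)// normrZ.
  by apply: ler_wpM2l => //; exact: hist_norm_ub.
apply/eqP; rewrite eq_le le_normZ/=.
have [->|a0] := eqVneq a 0; first by rewrite normr0 mul0r hist_norm_ge0.
rewrite -[in leLHS](scale1r f) -(mulVf a0) -scalerA.
rewrite mulrC -ler_pdivlMr ?normr_gt0//.
by rewrite (le_trans (le_normZ _ _))// normfV mulrC.
Qed.

Lemma hist_norm0_eq0 (f : hist) : hist_norm f = 0 -> f = 0.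
Proof.
move=> f0; apply/val_inj/funext => s /=.
have [rs0|rs0] := boolP (s \in `[- r, 0]).
  by apply/eqP; rewrite -normr_le0 -f0 hist_norm_ub.
by case: f rs0 {f0} => f /= /histP[_ /(_ s)]; apply.
Qed.

HB.instance Definition _ :=
  Lmodule_isNormed.Build R hist hist_normD hist_normZ hist_norm0_eq0.

End hist_def.

(* For y continuous on [-r, +oo[ and 0 <= t this is y_t (see segmentE). *)
Definition segment {R : realType} (r : R) (m : nat) (y : R -> 'cV[R]_m)
  (t : R) : hist r m :=
  insubd 0 (fun s => if s \in `[- r, 0] then y (t + s) else 0).

Lemma segmentE {R : realType} (r : R) (m : nat) (y : R -> 'cV[R]_m) (t s : R) :
  {within `[- r, +oo[, continuous y} -> 0 <= t -> s \in `[- r, 0] ->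
  segment r y t s = y (t + s).
Proof.
move=> cy t0 rs0; rewrite /segment /insubd insubT/= ?rs0//.
apply/histP; split=> [|u /negbTE ->//].
apply/subspace_continuousP => u ru0 P.
rewrite /from_subspace (ru0 : u \in `[- r, 0]).
move/subspace_continuousP: cy => cy /(cy (t + u)) yP.
have tr v : v \in `[- r, 0] -> `[- r, +oo[%classic (t + v).
  rewrite /= !in_itv/= andbT => /andP[rv _].
  by rewrite (le_trans rv)// lerDr.
have /yP{}yP := tr _ ru0.
have ct : (t + v) @[v --> u] --> t + u.
  by apply: cvgD; [exact: cvg_cst|exact: cvg_id].
have yPt : \forall v \near u, `[- r, +oo[%classic (t + v) -> P (y (t + v)).
  exact: ct yP.
rewrite /fmap/= /within/=; apply: filterS yPt => v yPv rv0 /=.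
rewrite (rv0 : v \in `[- r, 0]); exact: yPv (tr _ rv0).
Qed.

Section order.
Context {R : realType} {m : nat}.
Implicit Types (u v : 'cV[R]_m) (B : 'M[R]_m).

Definition vle u v := forall i, u i ord0 <= v i ord0.

Definition vlt u v := forall i, u i ord0 < v i ord0.

Definition quasipositive B := forall i j, i != j -> 0 <= B i j.

(* The exponential e^A; the series always converges. *)
Definition expmx (A : 'M[R]_m) : 'M[R]_m :=
  limn (series (fun k => (k`!%:R)^-1 *: A ^+ k)).

Context {r : R}.
Implicit Types (phi psi : hist r m).

Definition hist_le phi psi := forall s, s \in `[- r, 0] -> vle (phi s) (psi s).

Definition hist_lt phi psi := forall s, s \in `[- r, 0] -> vlt (phi s) (psi s).

Definition exp_cone B : set (hist r m) :=
  [set phi : hist r m | hist_le 0 phi /\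
    forall s t, - r <= s -> s <= t -> t <= 0 ->
      vle (expmx ((t - s) *: B) *m phi s) (phi t)].

Definition exp_le B phi psi := exp_cone B (psi - phi).

(* The interior of exp_cone B within the Lipschitz functions (for the Lipschitz
   norm), by its explicit description.  Elements of hist jump at the endpoints,
   where derivable may fail; these two points are negligible. *)
Definition exp_cone_int B : set (hist r m) :=
  [set phi : hist r m | [lipschitz phi s | s in `[- r, 0]] /\
    hist_lt 0 phi /\
    exists2 e : R, 0 < e &
      {ae lebesgue_measure, forall t, t \in `[- r, 0] ->
        derivable (phi : R -> 'cV[R]_m) t 1 /\
        vle (const_mx e) ('D_1 (phi : R -> 'cV[R]_m) t - B *m phi t)}].

End order.

Section flow.
Context {R : realType} {Omega : topologicalType}.

Definition continuous_flow (flow : R -> Omega -> Omega) :=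
  [/\ continuous (fun p : R * Omega => flow p.1 p.2),
      forall w, flow 0 w = w &
      forall s t w, flow (s + t) w = flow s (flow t w)].

(* No proper nonempty closed invariant subset. *)
Definition minimal_flow (flow : R -> Omega -> Omega) :=
  forall A : set Omega, closed A -> A !=set0 ->
    (forall t, flow t @` A = A) -> A = setT.

End flow.

Section delay_equation.
Context {R : realType} {Omega : pseudoMetricType R} {r : R} {m : nat}.
Variables (flow : R -> Omega -> Omega) (F : Omega -> hist r m -> 'cV[R]_m).

(* The derivative in the second variable exists in the sense of Frechet and
   is continuous on Omega * X for the operator norm. *)
Definition C1_snd :=
  (forall w phi, differentiable (F w) phi) /\
  (forall w phi (e : R), 0 < e ->
    nbhs (w, phi) [set p : Omega * hist r m | forall h : hist r m,
      `|'d (F p.1) (p.2) h - 'd (F w) phi h| <= e * `|h|]).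

(* y is a solution on [-r, +oo[; its values on ]-oo, -r[ are irrelevant, and
   y'(0) is the right derivative. *)
Definition is_solution (w : Omega) (phi : hist r m) (y : R -> 'cV[R]_m) :=
  [/\ {within `[- r, +oo[, continuous y},
      forall s, s \in `[- r, 0] -> y s = phi s,
      h^-1 *: (y h - y 0) @[h --> 0^'+] --> F w (segment r y 0) &
      forall t : R, 0 < t -> is_derive t 1 y (F (flow t w) (segment r y t))].

(* Uniqueness on [-r, +oo[ is a consequence of C1_snd. *)
Definition globally_defined := forall w phi, exists y, is_solution w phi y.

Definition solution (w : Omega) (phi : hist r m) : R -> 'cV[R]_m :=
  xget (cst 0) [set y | is_solution w phi y].

Definition skew_product (t : R) (p : Omega * hist r m) : Omega * hist r m :=
  (flow t p.1, segment r (solution p.1 p.2) t).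

End delay_equation.

(* Uniform persistence in exp_cone_int B of a semiflow on Omega * X. *)
Definition uniformly_persistent {R : realType} {Omega : Type} {r : R} {m : nat}
    (B : 'M[R]_m) (tau : R -> Omega * hist r m -> Omega * hist r m) :=
  exists2 psi, exp_cone_int B psi &
    forall w phi, exp_cone_int B phi ->
      exists2 t0 : R, 0 <= t0 &
        forall t, t0 <= t -> exp_le B psi (tau t (w, phi)).2.

(* Main.v *)
(* Put G(t) = y'(t) - B y(t) along a solution y issued from phi >>_B 0.
   - phi is in K_B, because e^((t - s)B) phi(s) is Lipschitz in s with an almost
     everywhere nonnegative derivative.  As long as G >= 0, y_t is in K_B and
     y_t >> 0, so the monotonicity of F between 0 and y_t gives
     G(t) >> F(w.t, 0) >= 0; hence this holds for all t >= 0.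
   - By minimality and compactness every orbit visits a neighbourhood of w0,
     where F(., 0) >> 0, within a uniform time and stays there for a uniform
     time.  Since y_i' + k y_i >= F_i(w.t, 0), all y_i(t) eventually exceed some
     c > 0 that depends neither on w nor on phi.
   - Then y_t >=_B chi with chi(s) = e^((s + r)B) c, so G(t) is bounded below by
     F(w.t, chi) - B chi(0), which is uniformly positive by compactness.
   - These two lower bounds, on y(t - r) and on G, give y_t >=_B psi for
     psi(s) = a e^(ks) (1, ..., 1) with k large and a small. *)
Require Import Defs.
From HB Require Import structures.
From mathcomp Require Import all_boot all_order all_algebra.
From mathcomp Require Import all_classical all_reals all_analysis.
From mathcomp Require Import ring lra.

Set Implicit Arguments.
Unset Strict Implicit.
Unset Printing Implicit Defensive.
Import Order.TTheory GRing.Theory Num.Theory.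
Import numFieldNormedType.Exports.

Local Open Scope classical_set_scope.
Local Open Scope ring_scope.

Lemma cvg_mx (T : Type) (F : set_system T) (FF : Filter F) (K : numFieldType)
    (p q : nat) (f : T -> 'M[K]_(p, q)) (L : 'M[K]_(p, q)) :
  (forall i j, f x i j @[x --> F] --> L i j) -> f x @[x --> F] --> L.
Proof.
move=> fL A [P LP PA]; rewrite /nbhs/=.
have : \forall x \near F, forall i j, P i j (f x i j).
  by apply: filter_forall => i; apply: filter_forall => j; exact: (fL i j _ (LP i j)).
by apply: filterS => x fP; exact: PA.
Qed.

(** * Matrix exponential *)

Section exponential.
Context {R : realType} {m : nat}.
Implicit Types (A B : 'M[R]_m) (t s : R).

(** Coefficients in [t] of the entry [(i, j)] of [B^n e^(tB)]. Carrying the power [n] turns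
    differentiation into the shift from [n] to [n.+1]. *)
Let exp_coef B n i j k : R := (B ^+ (k + n)) i j / k`!%:R.

Let entry_sum B : R := \sum_i \sum_j `|B i j|.

Let entry_sum_ge0 B : 0 <= entry_sum B.
Proof. by apply: sumr_ge0 => i _; apply: sumr_ge0 => j _. Qed.

(** Induction on [k]: every row sum of absolute values is at most [entry_sum B]. *)
Let exp_entry_le B k i j : `|(B ^+ k) i j| <= entry_sum B ^+ k.
Proof.
elim: k i j => [|k IH] i j.
  by rewrite !expr0 mxE; case: (i == j); rewrite ?normr0 ?normr1.
rewrite exprS exprS mxE (le_trans (ler_norm_sum _ _ _))//.
rewrite (le_trans (y := \sum_l `|B i l| * entry_sum B ^+ k))//.
  by apply: ler_sum => l _; rewrite normrM ler_wpM2l.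
rewrite -mulr_suml ler_wpM2r ?exprn_ge0//.
rewrite /entry_sum [leRHS](bigD1 i)//= lerDl.
by apply: sumr_ge0 => ? _; apply: sumr_ge0.
Qed.

Let exp_entry_cvg B n i j x : cvgn (pseries (exp_coef B n i j) x).
Proof.
apply: normed_cvg; set S := entry_sum B.
(* The dominating series sums to [S^n e^(S |x|)]. *)
apply: (@series_le_cvg _ _ (fun k => S ^+ n * exp_coeff (S * `|x|) k)).
- by move=> k; exact: normr_ge0.
- by move=> k; rewrite mulr_ge0 ?exprn_ge0 ?exp_coeff_ge0 ?mulr_ge0 ?entry_sum_ge0.
- move=> k; rewrite /exp_coef/= /exp_coeff/= !normrM normrX normfV.
  rewrite (ger0_norm (ler0n _ _)).
  rewrite [leRHS](_ : _ = S ^+ (k + n) / k`!%:R * `|x| ^+ k).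
    by rewrite ler_wpM2r ?exprn_ge0// ler_wpM2r ?invr_ge0 ?ler0n//; exact: exp_entry_le.
  by rewrite exprMn exprD; ring.
- rewrite (_ : series _ = (fun N => S ^+ n * series (exp_coeff (S * `|x|)) N)).
    by apply: is_cvgMl_tmp; exact: is_cvg_series_exp_coeff.
  by apply/funext => N; rewrite /series/= mulr_sumr.
Qed.

Let expn B n t : 'M[R]_m := \matrix_(i, j) limn (pseries (exp_coef B n i j) t).

Let exp_scale t B k : (t *: B) ^+ k = t ^+ k *: B ^+ k.
Proof.
elim: k => [|k IH]; first by rewrite !expr0 scale1r.
rewrite !exprS IH -[LHS]/((t *: B) *m (t ^+ k *: B ^+ k)).
by rewrite -scalemxAl -scalemxAr scalerA.
Qed.

Let expmx_expn B t : expmx (t *: B) = expn B 0 t.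
Proof.
apply: cvg_lim => //; apply: cvg_mx => i j; rewrite mxE.
rewrite (_ : (fun x => _) = pseries (exp_coef B 0 i j) t); first exact: exp_entry_cvg.
apply/funext => n; rewrite /pseries /series/= summxE; apply: eq_bigr => k _.
by rewrite exp_scale !mxE /exp_coef addn0; ring.
Qed.

(** Termwise differentiation: [(k+1) / (k+1)! = 1 / k!] turns the differentiated coefficients into
    those with [n.+1]. *)
Let expn_derive B n t i j :
  is_derive t 1 (fun t => expn B n t i j) (expn B n.+1 t i j).
Proof.
have diffs k : pseries_diffs (exp_coef B k i j) = exp_coef B k.+1 i j.
  apply/funext => l; rewrite /pseries_diffs /exp_coef addnS addSn factS natrM.
  by rewrite invfM mulrCA mulrA mulrA mulfK// pnatr_eq0.
rewrite (_ : (fun t => _) = (fun t => limn (pseries (exp_coef B n i j) t))); last first.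
  by apply/funext => u; rewrite mxE.
(* [|t| + 1] lies beyond [|t|]; the series and its first two formal derivatives converge there. *)
rewrite mxE -diffs; apply: (@pseries_snd_diffs _ _ (`|t| + 1)); rewrite ?diffs //.
by rewrite (ger0_norm (addr_ge0 _ _))// ltrDl.
Qed.

Let expnSl B n t : expn B n.+1 t = B *m expn B n t.
Proof.
apply/matrixP => i j; rewrite !mxE; apply: cvg_lim => //.
rewrite (_ : pseries _ _ =
    fun N => \sum_l B i l * pseries (exp_coef B n l j) t N).
  apply: cvg_big => [|l _]; first exact: add_continuous.
  by rewrite mxE; apply: cvgMl_tmp; exact: exp_entry_cvg.
apply/funext => N; rewrite /pseries /series/=.
under [RHS]eq_bigr do rewrite mulr_sumr.
rewrite exchange_big/=; apply: eq_bigr => k _.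
rewrite /exp_coef addnS exprS mxE !mulr_suml.
by apply: eq_bigr => l _; rewrite !mulrA.
Qed.

(** Taking a factor [B] out of [B^(k+n+1)] on the right here, and on the left in [expnSl], makes [B]
    commute with its exponential. *)
Let expnSr B n t : expn B n.+1 t = expn B n t *m B.
Proof.
apply/matrixP => i j; rewrite !mxE; apply: cvg_lim => //.
rewrite (_ : pseries _ _ =
    fun N => \sum_l pseries (exp_coef B n i l) t N * B l j).
  apply: cvg_big => [|l _]; first exact: add_continuous.
  by rewrite mxE; apply: cvgMr_tmp; exact: exp_entry_cvg.
apply/funext => N; rewrite /pseries /series/=.
under [RHS]eq_bigr do rewrite mulr_suml.
rewrite exchange_big/=; apply: eq_bigr => k _.
rewrite /exp_coef addnS exprSr mxE !mulr_suml.
by apply: eq_bigr => l _; ring.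
Qed.

Lemma expmx0 B : expmx (0 *: B) = 1%:M.
Proof.
rewrite expmx_expn; apply/matrixP => i j; rewrite !mxE.
apply: cvg_lim => //; apply: cvg_near_cst.
near=> N; rewrite /pseries /series/=.
have -> : N = N.-1.+1 by rewrite prednK//; near: N; exact: nbhs_infty_gt.
rewrite big_nat_recl//= big1 => [|k _]; last by rewrite expr0n/= mulr0.
by rewrite /exp_coef/= fact0 divr1 expr0 mulr1 addr0 expr0 mxE.
Unshelve. all: by end_near. Qed.

Lemma expmx_comm B t : B *m expmx (t *: B) = expmx (t *: B) *m B.
Proof. by rewrite expmx_expn -expnSl expnSr. Qed.

Lemma is_derive_expmx B t i j :
  is_derive t 1 (fun t => expmx (t *: B) i j) ((expmx (t *: B) *m B) i j).
Proof.
rewrite expmx_expn -expnSr.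
rewrite (_ : (fun t => _) = (fun t => expn B 0 t i j)); first exact: expn_derive.
by apply/funext => u; rewrite expmx_expn.
Qed.

(** The term of index 0 of the series is the identity, and the later terms are nonnegative. *)
Lemma expmx_nneg A : (forall i j, 0 <= A i j) ->
  forall t, 0 <= t -> forall i j, (i == j)%:R <= expmx (t *: A) i j.
Proof.
move=> A0 t t0 i j; rewrite expmx_expn mxE.
have Ak k : forall i j, 0 <= (A ^+ k) i j.
  elim: k => [|k IH] i' j'; first by rewrite expr0 mxE ler0n.
  by rewrite exprS mxE; apply: sumr_ge0 => l _; rewrite mulr_ge0.
apply: limr_ge; first exact: exp_entry_cvg.
near=> N; rewrite /pseries /series/=.
have -> : N = N.-1.+1 by rewrite prednK//; near: N; exact: nbhs_infty_gt.
rewrite big_nat_recl//= /exp_coef/= fact0 divr1 expr0 mulr1 expr0 mxE lerDl.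
by apply: sumr_ge0 => k _; rewrite mulr_ge0 ?exprn_ge0// divr_ge0 ?ler0n.
Unshelve. all: by end_near. Qed.

End exponential.

(** * Entrywise differentiation of matrix functions *)

Section derive_mulmx.
Context {R : realType}.

Lemma is_derive_mulmx (p q n : nat) (A : R -> 'M[R]_(p, q))
    (dA : 'M[R]_(p, q)) (C : R -> 'M[R]_(q, n)) (dC : 'M[R]_(q, n)) (t : R) :
  (forall i j, is_derive t 1 (fun t => A t i j) (dA i j)) ->
  (forall i j, is_derive t 1 (fun t => C t i j) (dC i j)) ->
  forall i j, is_derive t 1 (fun t => (A t *m C t) i j)
    ((dA *m C t + A t *m dC) i j).
Proof.
move=> dAt dCt i j.
rewrite (_ : (fun t => _) = \sum_l ((fun t => A t i l) * (fun t => C t l j))).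
  apply: is_derive_eq; rewrite !mxE -big_split/=; apply: eq_bigr => l _.
  by rewrite /GRing.scale/=; ring.
by apply/funext => u; rewrite fct_sumE mxE.
Qed.

Lemma is_derive_affine (g : R -> R) (dg c s t : R) :
  is_derive (s * t + c) 1 g dg ->
  is_derive t 1 (fun t => g (s * t + c)) (s * dg).
Proof.
move=> gd; have -> : (fun t => g (s * t + c)) = g \o (fun t => s * t + c) by [].
have hd : is_derive t 1 (fun t : R => s * t + c) s.
  rewrite (_ : (fun t => _) = s *: (@id R) + cst c)//.
  by apply: is_derive_eq; rewrite addr0 scaler1.
by have := is_derive1_comp (f := g) (g := fun t => s * t + c) gd hd; rewrite mulrC.
Qed.

Lemma is_derive0_mx_cst (p q : nat) (A : R -> 'M[R]_(p, q)) :
  (forall (t : R) i j, is_derive t 1 (fun t => A t i j) 0) ->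
  forall s t, A s = A t.
Proof.
move=> A0 s t; apply/matrixP => i j.
exact: (is_derive_0_is_cst (f := fun t => A t i j)).
Qed.

End derive_mulmx.

(** * Group law and positivity of the exponential *)

Section exponential_group.
Context {R : realType} {m : nat}.
Implicit Types (A B : 'M[R]_m) (s t : R).

Lemma is_derive_expmx_affine B c s t i j :
  is_derive t 1 (fun t => expmx ((s * t + c) *: B) i j)
    (s * (expmx ((s * t + c) *: B) *m B) i j).
Proof.
exact: (is_derive_affine (g := fun t => expmx (t *: B) i j) (is_derive_expmx _ _ _ _)).
Qed.

Lemma expmxN_mul B (G : R -> 'M[R]_m) :
  (forall (t : R) i j, is_derive t 1 (fun t => G t i j) ((B *m G t) i j)) ->
  forall t, expmx ((- t) *: B) *m G t = G 0.
Proof.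
move=> dG t.
(* By the product rule [H' = - e^(-tB) B G + e^(-tB) B G = 0]. The argument is written [-1 * t + 0]
   to match [is_derive_expmx_affine]. *)
pose H t := expmx ((-1 * t + 0) *: B) *m G t.
have dH (u : R) i j : is_derive u 1 (fun t => H t i j) 0.
  have := @is_derive_mulmx R _ _ _ (fun t => expmx ((-1 * t + 0) *: B))
    (- (expmx ((-1 * u + 0) *: B) *m B)) G (B *m G u) u.
  move=> /(_ _ (dG u) i j); rewrite mulNmx -mulmxA addNr mxE; apply.
  move=> {}i {}j; rewrite [X in is_derive _ _ _ X]mxE -[X in is_derive _ _ _ X]mulN1r.
  exact: is_derive_expmx_affine.
have := is_derive0_mx_cst dH t 0.
by rewrite /H mulr0 !addr0 expmx0 mul1mx mulN1r.
Qed.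

(* Uniqueness for X' = B X, obtained from [(e^(-tB) X)' = 0]. *)
Lemma expmx_unique B (G : R -> 'M[R]_m) :
  (forall (t : R) i j, is_derive t 1 (fun t => G t i j) ((B *m G t) i j)) ->
  forall t, G t = expmx (t *: B) *m G 0.
Proof.
move=> dG t.
have EK : expmx ((- t) *: B) *m expmx (t *: B) = 1%:M.
  have dE (u : R) i j : is_derive u 1 (fun t => expmx (t *: B) i j)
      ((B *m expmx (u *: B)) i j).
    by rewrite expmx_comm; exact: is_derive_expmx.
  by rewrite (expmxN_mul dE t) expmx0.
by rewrite -(expmxN_mul dG t) mulmxA (mulmx1C EK) mul1mx.
Qed.

(** As functions of [s], both sides solve [X' = B X] with value [e^(tB)] at [s = 0]. *)
Lemma expmxD B s t :
  expmx ((s + t) *: B) = expmx (s *: B) *m expmx (t *: B).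
Proof.
have dE (u : R) i j : is_derive u 1 (fun s => expmx ((s + t) *: B) i j)
    ((B *m expmx ((u + t) *: B)) i j).
  rewrite (_ : (fun s => _) = fun s => expmx ((1 * s + t) *: B) i j).
    by have := is_derive_expmx_affine B t 1 u i j; rewrite !mul1r expmx_comm.
  by apply/funext => v; rewrite mul1r.
by rewrite (expmx_unique dE s) add0r.
Qed.

(* For large [k] the matrix [B + k] is nonnegative and
   [e^(tB) = e^(-kt) e^(t(B + k))]. *)
Lemma expmx_quasipositive B : quasipositive B -> forall t, 0 <= t ->
  exists2 c, 0 < c & forall i j, (i == j)%:R * c <= expmx (t *: B) i j.
Proof.
move=> Bqp t t0; pose k := \sum_i `|B i i|.
pose A := B + k%:M.
have A0 i j : 0 <= A i j.
  rewrite !mxE; have [<-|/Bqp] := eqVneq i j; last by rewrite addr0.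
  rewrite mulr1n -lerBlDl sub0r (le_trans (ler_norm _))// normrN /k (bigD1 i)//=.
  by rewrite lerDl sumr_ge0.
(* [G] solves [G' = B G] with [G 0 = 1], so uniqueness identifies it with [e^(tB)]. *)
pose G t := expR (- k * t) *: expmx (t *: A).
have dG (u : R) i j : is_derive u 1 (fun u => G u i j) ((B *m G u) i j).
  have dE : is_derive u 1 (fun u => expR (- k * u + 0)) (- k * expR (- k * u + 0)).
    exact: is_derive_affine.
  have dA := is_derive_expmx A u i j.
  rewrite (_ : (fun t => _) =
     (fun u => expR (- k * u + 0)) * (fun u => expmx (u *: A) i j)).
    apply: is_derive_eq.
    rewrite /G -expmx_comm /A mulmxDl mul_scalar_mx -scalemxAr addr0 !mxE.
    by rewrite /GRing.scale/=; ring.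
  by apply/funext => v; rewrite fctE addr0 /G mxE.
have -> : expmx (t *: B) = G t.
  rewrite (expmx_unique dG) /G scale0r mulr0 expR0 scale1r.
  by rewrite -(scale0r A) expmx0 mulmx1.
exists (expR (- k * t)) => [|i j]; first exact: expR_gt0.
rewrite mxE mulrC ler_wpM2l ?expR_ge0//.
exact: expmx_nneg.
Qed.

Lemma expmx_ge0 B : quasipositive B -> forall t, 0 <= t ->
  forall i j, 0 <= expmx (t *: B) i j.
Proof.
move=> Bqp t t0 i j; have [c c0 /(_ i j)] := expmx_quasipositive Bqp t0.
by apply: le_trans; rewrite mulr_ge0 ?ler0n// ltW.
Qed.

Lemma expmx_vge0 B (v : 'cV[R]_m) : quasipositive B -> forall t, 0 <= t ->
  vle 0 v -> vle 0 (expmx (t *: B) *m v).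
Proof.
move=> Bqp t t0 v0 i; rewrite !mxE; apply: sumr_ge0 => j _.
by rewrite mulr_ge0 ?expmx_ge0//; have := v0 j; rewrite mxE.
Qed.

(** Strictness comes from the diagonal entry, which is bounded below by a positive constant; the
    off-diagonal terms are only nonnegative. *)
Lemma expmx_vgt0 B (v : 'cV[R]_m) : quasipositive B -> forall t, 0 <= t ->
  vlt 0 v -> vlt 0 (expmx (t *: B) *m v).
Proof.
move=> Bqp t t0 v0 i; rewrite !mxE (bigD1 i)//=.
have v0' j : 0 < v j 0 by have := v0 j; rewrite mxE.
have [c c0 /(_ i i)] := expmx_quasipositive Bqp t0.
rewrite eqxx mul1r => /(lt_le_trans c0) E0.
rewrite ltr_pwDl ?mulr_gt0//; apply: sumr_ge0 => j _.
by rewrite mulr_ge0 ?expmx_ge0// ltW.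
Qed.

End exponential_group.

(** * Monotonicity from an almost everywhere derivative *)

Section monotone.
Context {R : realType}.
Implicit Types (a b : R).

(** Apply the hypothesis at the infimum of the failure times: [P] then holds on an interval that
    starts at the infimum and includes it, so failure times stay away from their infimum. *)
Lemma real_induction (P : R -> Prop) a :
  (forall t, a <= t -> (forall u, a <= u -> u < t -> P u) ->
    exists2 d, 0 < d & forall v, t <= v -> v < t + d -> P v) ->
  forall t, a <= t -> P t.
Proof.
move=> ind t at_; apply: contrapT => nPt.
pose S := [set u | a <= u /\ ~ P u].
have hS : has_inf S by split; [exists t | exists a => u []].
have aS : a <= inf S by apply: lb_le_inf; [exists t | move=> u []].
have [u au uS|d d0 Pd] := ind _ aS.
  apply: contrapT => nPu; suff : inf S <= u by rewrite leNgt uS.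
  by apply: ge_inf; [exact: hS.2|].
have [u [au nPu] ud] := inf_adherent d0 hS.
by apply/nPu/Pd => //; apply: ge_inf; [exact: hS.2|].
Qed.

(** Real induction on [h a <= h t]: the left half of the local condition reaches [t] from an earlier
    point, the right half continues past [t]. *)
Lemma locally_nondecreasing_le (h : R -> R) a b : a <= b ->
  (forall x, a <= x -> x <= b -> exists2 d, 0 < d &
    forall y, a <= y -> y <= b -> `|y - x| < d ->
      (y <= x -> h y <= h x) /\ (x <= y -> h x <= h y)) ->
  h a <= h b.
Proof.
move=> ab loc; suff : forall t, a <= t -> t <= b -> h a <= h t by apply.
apply: real_induction => t at_ IH.
have [tb|bt] := leP t b; last first.
  by exists 1 => // v tv _ vb; have := lt_le_trans bt (le_trans tv vb); rewrite ltxx.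
have [d d0 dP] := loc t at_ tb.
have hat : h a <= h t.
  have [->//|a_t] := eqVneq a t.
  have {a_t}at1 : a < t by rewrite lt_neqAle a_t.
  (* A point strictly left of [t], within [d / 2] of it and clipped to stay in [[a, b]]. *)
  pose u := Num.max a (t - d / 2).
  have ut : u < t by rewrite gt_max at1/= ltrBlDr ltrDl divr_gt0.
  have au : a <= u by rewrite le_max lexx.
  apply: (@le_trans _ _ (h u)).
    by apply: IH => //; exact: le_trans (ltW ut) tb.
  have [] // := dP u au (le_trans (ltW ut) tb).
    rewrite distrC ger0_norm ?subr_ge0 ?(ltW ut)// ltrBlDl -ltrBlDr.
    by rewrite lt_max; apply/orP; right; lra.
  by move=> /(_ (ltW ut)).
exists d => // v tv vd vb; apply: (le_trans hat).
have [] // := dP v (le_trans at_ tv) vb.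
  by rewrite ger0_norm ?subr_ge0// ltrBlDl.
by move=> _; apply.
Qed.

(* [k * mu (U `&` ]a, x])] has slope [k] on an open [U] of small measure
   covering the exceptional null set, which compensates the possible decrease
   of [f] there. *)
Lemma lipschitz_ae_derive_ge0_le (f : R -> R) a b (k : R) : a <= b -> 0 <= k ->
  (forall x y, a <= x -> x <= y -> y <= b -> `|f y - f x| <= k * (y - x)) ->
  {ae lebesgue_measure, forall t, t \in `[a, b] -> derivable f t 1 /\ 0 <= 'D_1 f t} ->
  f a <= f b.
Proof.
move=> ab k0 lip [N [mN N0 sN]].
pose mu : {measure set (measurableTypeR R) -> \bar R} := @lebesgue_measure R.
have {}N0 : mu N = 0%E by exact: N0.
apply/ler_addgt0Pr => /= e e0.
(* Error budget: the tilt [eta * x] costs at most [e / 2] over [[a, b]], and [k] times the measure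
   [del] of [U] at most [e / 2]. The [+ 1] keeps the denominators positive. *)
pose eta := e / 2 / (b - a + 1); pose del := e / 2 / (k + 1).
have eta0 : 0 < eta by rewrite !divr_gt0// ltr_wpDl// subr_ge0.
have del0 : 0 < del by rewrite !divr_gt0// ltr_wpDl.
have [U [oU NU UN]] : exists U : set R, [/\ open U, N `<=` U & (mu (U `\` N) < del%:E)%E].
  by apply: lebesgue_regularity_outer => //; rewrite N0 ltry.
have mU : measurable U by exact: measurable_realfun.open_measurable.
have muU : (mu U <= del%:E)%E.
  rewrite (_ : U = N `|` (U `\` N)); last by rewrite setDUK.
  rewrite (le_trans (measureU2 _ _ _))//; first exact: measurableD.
  by rewrite [X in (X + _)%E](_ : _ = 0%E)// add0e ltW.
have mUi x : measurable (U `&` `]a, x]) by apply: measurableI.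
have muUi x : (mu (U `&` `]a, x]) <= del%:E)%E.
  by rewrite (le_trans _ muU)// le_measure ?inE//; exact: mUi.
have finUi x : mu (U `&` `]a, x]) \is a fin_num.
  by rewrite ge0_fin_numE// (le_lt_trans (muUi x))// ltry.
pose g x := fine (mu (U `&` `]a, x])).
have g_homo x y : x <= y -> g x <= g y.
  move=> xy; apply: fine_le => //; rewrite le_measure ?inE//; [exact: mUi..|].
  by apply: setIS; apply: subset_itvl; rewrite bnd_simp.
have g_slope x y : a <= x -> x <= y -> `[x, y] `<=` U -> y - x <= g y - g x.
  move=> ax xy xyU; rewrite -lee_fin !EFinB !fineK//.
  have -> : U `&` `]a, y] = (U `&` `]a, x]) `|` `]x, y].
    rewrite (@itv_bndbnd_setU _ _ _ (BRight x)) ?bnd_simp//.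
    rewrite setIUr; congr (_ `|` _); apply/setIidr => z zxy.
    by apply: xyU; move: zxy; rewrite /= !in_itv/= => /andP[/ltW -> ->].
  rewrite measureU//; last first.
    apply/seteqP; split => // z [[_]]; rewrite /= !in_itv/= => /andP[_ zx] /andP[xz _].
    by have := lt_le_trans xz zx; rewrite ltxx.
  - exact: mUi.
  rewrite addeAC subee ?finUi// add0r [leRHS](lebesgue_measure_itv `]x, y])/= lte_fin.
  by move: xy; rewrite le_eqVlt => /predU1P[->|->//]; rewrite ltxx subee.
have gE : g a = 0 by rewrite /g set_itvoc0 ?lexx// setI0 measure0.
have gb : g b <= del by rewrite -lee_fin fineK.
(* Near a point of [N], the slope [k] of [k * g] offsets the Lipschitz loss of [f]. At any other
   point the derivative is nonnegative and [eta * x] absorbs the error of the difference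
   quotient. *)
pose h x := f x + k * g x + eta * x.
have : h a <= h b.
  apply: locally_nondecreasing_le => // x ax xb.
  have [/NU xU|xN] := pselect (N x).
    have /nbhs_ballP[d /= d0 dU] := open_nbhs_nbhs (conj oU xU).
    have sub u v : u <= v -> `|u - x| < d -> `|v - x| < d -> `[u, v] `<=` U.
      move=> uv ud vd z /=; rewrite in_itv/= => /andP[uz zv]; apply: dU.
      rewrite -ball_normE /= ltr_norml; move: ud vd; rewrite !ltr_norml.
      by move=> /andP[? ?] /andP[? ?]; apply/andP; split; lra.
    have mono u v : a <= u -> u <= v -> v <= b ->
        `|u - x| < d -> `|v - x| < d -> h u <= h v.
      move=> au uv vb ud vd.
      have := lip _ _ au uv vb; rewrite ler_norml => /andP[fuv _].
      have := g_slope _ _ au uv (sub _ _ uv ud vd) => /(ler_wpM2l k0) guv.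
      have : eta * u <= eta * v by rewrite ler_wpM2l// ltW.
      by rewrite /h; lra.
    exists d => // y ay yb yx.
    by split => xy; apply: mono; rewrite ?subrr ?normr0.
  have [df Df] : derivable f x 1 /\ 0 <= 'D_1 f x.
    apply: contrapT => nP; apply/xN/sN => /= P; apply/nP/P.
    by rewrite in_itv/= ax.
  move/cvgrPdist_lt : df => /(_ _ eta0).
  move=> /nbhs_ballP[d /= d0 dP].
  exists d => // y ay yb yx.
  have [->|xy] := eqVneq y x; first by [].
  have := dP (y - x); rewrite -ball_normE /= sub0r normrN => /(_ yx).
  rewrite subr_eq0 => /(_ xy); rewrite -/(derive f x 1) scaler1 subrK.
  rewrite /GRing.scale/= => D.
  have {}D : - eta < (y - x)^-1 * (f y - f x).
    by move: D; rewrite ltr_norml => /andP[_ D]; lra.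
  split => yx'.
    have yx0 : y - x < 0 by rewrite subr_lt0 lt_neqAle xy.
    have := g_homo _ _ yx' => /(ler_wpM2l k0) guv.
    move: D; rewrite mulrC ltr_ndivlMr// => D.
    by rewrite /h; lra.
  have yx0 : 0 < y - x by rewrite subr_gt0 lt_neqAle eq_sym xy.
  have := g_homo _ _ yx' => /(ler_wpM2l k0) guv.
  move: D; rewrite mulrC ltr_pdivlMr// => D.
  by rewrite /h; lra.
rewrite /h gE mulr0 addr0 => hab.
have kg : k * g b <= e / 2.
  apply: (@le_trans _ _ ((k + 1) * del)).
    by apply: ler_pM => //; rewrite ?lerDl// -gE g_homo.
  by rewrite /del mulrC divfK// gt_eqF// ltr_wpDl.
have etab : eta * (b - a) <= e / 2.
  apply: (@le_trans _ _ (eta * (b - a + 1))).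
    by rewrite ler_pM2l// lerDl.
  by rewrite /eta divfK// gt_eqF// ltr_wpDl// subr_ge0.
lra.
Qed.

End monotone.

Lemma is_derive_mx_coord (R : realType) (p q : nat) (f : R -> 'M[R]_(p, q))
    (df : 'M[R]_(p, q)) (t : R) :
  is_derive t 1 f df -> forall i j, is_derive t 1 (fun t => f t i j) (df i j).
Proof.
move=> [fD fE] i j; split; first by move/derivable_mxP: fD.
by rewrite -fE derive_mx// mxE.
Qed.

Lemma is_derive_mxP (R : realType) (p q : nat) (f : R -> 'M[R]_(p, q))
    (df : 'M[R]_(p, q)) (t : R) :
  (forall i j, is_derive t 1 (fun t => f t i j) (df i j)) -> is_derive t 1 f df.
Proof.
move=> fD; have dft : derivable f t 1 by apply/derivable_mxP => i j; case: (fD i j).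
split=> //; rewrite derive_mx//; apply/matrixP => i j; rewrite mxE.
by case: (fD i j).
Qed.

Lemma is_derive_within_continuous (R : realType) (f df : R -> R) (A : set R) :
  (forall t : R, is_derive t 1 f (df t)) -> {within A, continuous f}.
Proof.
move=> fD; apply: continuous_subspaceT => t.
by apply/differentiable_continuous/derivable1_diffP; case: (fD t).
Qed.

(** * Differential inequalities *)

Section lipschitz_bounded.
Context {R : realType}.
Implicit Types (f g : R -> R) (a b : R).

(** Boundedness is kept together with the Lipschitz condition so that the class is stable under
    products. *)
Definition lip_bounded a b f := exists2 k, 0 <= k &
  forall x y, a <= x -> x <= y -> y <= b ->
    `|f x| <= k /\ `|f y - f x| <= k * (y - x).

Lemma lip_boundedM a b f g :
  lip_bounded a b f -> lip_bounded a b g -> lip_bounded a b (fun x => f x * g x).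
Proof.
move=> [k k0 fk] [l l0 gl]; exists (2 * k * l); first by rewrite !mulr_ge0.
have kl0 : 0 <= k * l by rewrite mulr_ge0.
move=> x y ax xy yb; have xy0 : 0 <= y - x by rewrite subr_ge0.
have [fx fxy] := fk x y ax xy yb; have [gx gxy] := gl x y ax xy yb.
have [fy _] := fk y y (le_trans ax xy) (lexx _) yb.
split; first by rewrite normrM (le_trans (ler_pM _ _ fx gx))//; lra.
rewrite (_ : _ - _ = f y * (g y - g x) + (f y - f x) * g x); last by ring.
rewrite (le_trans (ler_normD _ _))// !normrM.
have := ler_pM (normr_ge0 _) (normr_ge0 _) fy gxy.
have := ler_pM (normr_ge0 _) (normr_ge0 _) fxy gx.
rewrite mulrAC mulrA; lra.
Qed.

Lemma lip_bounded_sum a b n (f : 'I_n -> R -> R) :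
  (forall i, lip_bounded a b (f i)) -> lip_bounded a b (fun x => \sum_i f i x).
Proof.
move=> fk; have /choice[k kP] : forall i, exists k, 0 <= k /\
    forall x y, a <= x -> x <= y -> y <= b ->
      `|f i x| <= k /\ `|f i y - f i x| <= k * (y - x).
  by move=> i; have [k k0 ?] := fk i; exists k.
exists (\sum_i k i); first by apply: sumr_ge0 => i _; have [] := kP i.
move=> x y ax xy yb; split.
  rewrite (le_trans (ler_norm_sum _ _ _))//; apply: ler_sum => i _.
  by have [_ /(_ x y ax xy yb)[]] := kP i.
rewrite -sumrB (le_trans (ler_norm_sum _ _ _))// mulr_suml; apply: ler_sum => i _.
by have [_ /(_ x y ax xy yb)[]] := kP i.
Qed.

(** A continuous derivative is bounded on [[a, b]]; the mean value theorem does the rest. *)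
Lemma is_derive_lip_bounded a b f (df : R -> R) : a <= b ->
  (forall x : R, is_derive x 1 f (df x)) -> {within `[a, b], continuous df} ->
  lip_bounded a b f.
Proof.
move=> ab fD cdf.
have cf A : {within A, continuous f} by exact: is_derive_within_continuous fD.
have bnd (h : R -> R) : {within `[a, b], continuous h} ->
    exists2 M, 0 <= M & forall x, a <= x -> x <= b -> `|h x| <= M.
  move=> ch.
  have [] := EVT_max ab (f := fun x => `|h x|); first last.
    move=> c _ cM; exists `|h c| => // x ax xb; apply: cM.
    by rewrite in_itv/= ax.
  by move=> x; apply: continuous_comp; [exact: ch|exact: norm_continuous].
have [M M0 fM] := bnd _ (cf _); have [N N0 dfN] := bnd _ cdf.
exists (M + N); first exact: addr_ge0.
move=> x y ax xy yb; split.
  by rewrite (le_trans (fM _ ax (le_trans xy yb)))// lerDl.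
have [c /= cxy ->] := MVT_segment xy (fun x _ => fD x) (cf _).
move: cxy; rewrite in_itv/= => /andP[xc cy].
rewrite normrM (ger0_norm (x := y - x)) ?subr_ge0//.
rewrite ler_wpM2r ?subr_ge0// (le_trans (dfN c _ _)) ?lerDr//.
- exact: le_trans ax xc.
- exact: le_trans cy yb.
Qed.

End lipschitz_bounded.

(** * Integration of [f' >= B f] with a matrix integrating factor *)

Section differential_inequality.
Context {R : realType} {m : nat} (B : 'M[R]_m) (Bqp : quasipositive B).
Implicit Types (f : R -> 'cV[R]_m) (a b t : R).

Lemma is_derive_expmx_sub b t i j :
  is_derive t 1 (fun t => expmx ((b - t) *: B) i j)
    ((- (expmx ((b - t) *: B) *m B)) i j).
Proof.
have -> : (fun t => expmx ((b - t) *: B) i j) =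
    (fun t => expmx ((-1 * t + b) *: B) i j).
  by apply/funext => u; rewrite mulN1r addrC.
apply: is_derive_eq; first exact: is_derive_expmx_affine.
by rewrite mulN1r [RHS]mxE mulN1r addrC.
Qed.

(** At [t = a] and [t = b] this function takes the two sides of the cone inequality, and its
    derivative has the sign of [f' - B f] when [t <= b]. *)
Lemma is_derive_expmx_sub_mul f (df : 'cV[R]_m) b t i : is_derive t 1 f df ->
  is_derive t 1 (fun t => (expmx ((b - t) *: B) *m f t) i ord0)
    ((expmx ((b - t) *: B) *m (df - B *m f t)) i ord0).
Proof.
move=> fD; apply: is_derive_eq.
  apply: is_derive_mulmx; first exact: is_derive_expmx_sub.
  exact: is_derive_mx_coord fD.
by rewrite mulmxBr mulNmx mulmxA addrC.
Qed.

Lemma expmx_sub_mul_lip a b f i : a <= b ->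
  (forall j, lip_bounded a b (fun t => f t j ord0)) ->
  lip_bounded a b (fun t => (expmx ((b - t) *: B) *m f t) i ord0).
Proof.
move=> ab fl.
have -> : (fun t => (expmx ((b - t) *: B) *m f t) i ord0) =
    (fun t => \sum_j expmx ((b - t) *: B) i j * f t j ord0).
  by apply/funext => t; rewrite mxE.
apply: lip_bounded_sum => j; apply: lip_boundedM => //.
apply: (is_derive_lip_bounded ab (fun t => is_derive_expmx_sub b t i j)).
apply: (is_derive_within_continuous
  (df := fun t => (expmx ((b - t) *: B) *m B *m B) i j)) => t.
have -> : (fun t => (- (expmx ((b - t) *: B) *m B)) i j) =
    (fun t => (expmx ((b - t) *: B) *m (- B)) i j).
  by apply/funext => u; rewrite mulmxN.
apply: is_derive_eq.
  apply: (is_derive_mulmx (C := fun=> - B) (dC := 0)) => k l.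
    exact: is_derive_expmx_sub.
  by rewrite [X in is_derive _ _ _ X]mxE; exact: (is_derive_cst ((- B) k l)).
by rewrite mulmx0 addr0 mulmxN mulNmx opprK.
Qed.

(** The integrating-factor product is Lipschitz and has an almost everywhere nonnegative derivative.
    This version serves initial histories in [exp_cone_int B]. *)
Lemma ae_expmx_le f a b : a <= b ->
  (forall j, lip_bounded a b (fun t => f t j ord0)) ->
  {ae lebesgue_measure, forall t, t \in `[a, b] ->
    derivable f t 1 /\ vle 0 ('D_1 f t - B *m f t)} ->
  vle (expmx ((b - a) *: B) *m f a) (f b).
Proof.
move=> ab fl fD i.
have [k k0 kP] := expmx_sub_mul_lip i ab fl.
have := @lipschitz_ae_derive_ge0_le _ (fun t => (expmx ((b - t) *: B) *m f t) i ord0)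
  _ _ _ ab k0.
rewrite subrr expmx0 mul1mx; apply.
  by move=> x y ax xy yb; have [] := kP x y ax xy yb.
have [N [mN N0 sN]] := fD; exists N; split=> // t nP; apply: sN => /= {}fD.
apply: nP => /= tab; have [fd fge] := fD tab.
have /(is_derive_expmx_sub_mul b i) [uD ->] := derivableP fd.
split => //; move: tab; rewrite in_itv/= => /andP[_ tb].
by have := expmx_vge0 Bqp _ fge i; rewrite mxE; apply; rewrite subr_ge0.
Qed.

(** This version serves solutions: differentiability is asked only inside the interval, so it
    applies from time 0 on. *)
Lemma derive_expmx_le f (df : R -> 'cV[R]_m) a b : a <= b ->
  {within `[a, b], continuous f} ->
  (forall t, a < t -> t < b -> is_derive t 1 f (df t)) ->
  (forall t, a < t -> t < b -> vle 0 (df t - B *m f t)) ->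
  vle (expmx ((b - a) *: B) *m f a) (f b).
Proof.
move=> ab cf fD fge i.
pose u t := (expmx ((b - t) *: B) *m f t) i ord0.
have uD t : t \in `]a, b[ ->
    is_derive t 1 u ((expmx ((b - t) *: B) *m (df t - B *m f t)) i ord0).
  rewrite in_itv/= => /andP[a_t tb].
  by apply: is_derive_expmx_sub_mul; exact: fD.
have : u a <= u b; last by rewrite /u subrr expmx0 mul1mx.
apply: (@ger0_derive1_le_cc _ u a b) => //; rewrite ?in_itv/= ?lexx ?ab//.
- by move=> t /uD[].
- move=> t /[dup] tab /uD [_]; rewrite derive1E => ->.
  move: tab; rewrite in_itv/= => /andP[a_t tb].
  by have := expmx_vge0 Bqp _ (fge t a_t tb) i; rewrite mxE; apply; rewrite subr_ge0 ltW.
- rewrite (_ : u = fun t => \sum_j expmx ((b - t) *: B) i j * f t j ord0).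
    move=> t; apply: cvg_big => [|j _]; first exact: add_continuous.
    apply: cvgM.
      exact: (is_derive_within_continuous (fun t => is_derive_expmx_sub b t i j)).
    exact: (cvg_comp _ _ (cf t) (@coord_continuous _ _ _ j ord0 (f t))).
  by apply/funext => t; rewrite /u mxE.
Qed.

End differential_inequality.

Lemma mx_coord_norm_le (R : realType) (p q : nat) (M : 'M[R]_(p, q)) i j :
  `|M i j| <= `|M|.
Proof.
by rewrite [leRHS]/Num.norm/= mx_normrE (le_bigmax _ (fun ij => `|M ij.1 ij.2|) (i, j)).
Qed.

Lemma mx_norm_le (R : realType) (p q : nat) (M : 'M[R]_(p, q)) (c : R) :
  0 <= c -> (forall i j, `|M i j| <= c) -> `|M| <= c.
Proof.
by move=> c0 Mc; rewrite [leLHS]/Num.norm/= mx_normrE bigmax_le.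
Qed.

(** * History segments and the exponential cone *)

Section history.
Context {R : realType} {r : R} {m : nat}.
Implicit Types (y : R -> 'cV[R]_m) (phi psi : hist r m).

(** Moving the shift by [t] into [y] reduces to [segmentE] at time 0, so [t] may have any sign. *)
Lemma segment_contE y t s : continuous y -> s \in `[- r, 0] ->
  segment r y t s = y (t + s).
Proof.
move=> cy rs0; have -> : segment r y t = segment r (fun u => y (t + u)) 0.
  by rewrite /segment; congr insubd; apply/funext => u; rewrite add0r.
rewrite segmentE ?add0r//; apply: continuous_subspaceT => u.
by apply: continuous_comp; [apply: cvgD; [exact: cvg_cst|exact: cvg_id]|exact: cy].
Qed.

(** [y (v + s)] is jointly continuous, and compactness of [[-r, 0]] makes the estimate uniform in
    [s]. *)
Lemma segment_continuous y : continuous y -> continuous (segment r y).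
Proof.
move=> cy t; apply/cvgrPdist_le => e e0.
have yts (s : R) : \forall s' \near s & v \near t, `|y (t + s') - y (v + s')| <= e.
  have yc (p : R * R) : {for p, continuous (fun p => y (p.1 + p.2))}.
    by apply: continuous_comp; [exact: add_continuous|exact: cy].
  have /cvgrPdist_le/(_ (e / 2))/(_ ltac:(by rewrite divr_gt0)) := yc (t, s).
  case=> -[/= U V] [Ut Vs] UV; exists (V, U) => //= -[s' v]/= [Vs' Uv].
  have := UV (v, s') (conj Uv Vs'); have := UV (t, s') (conj (nbhs_singleton Ut) Vs').
  move=> /= ts' vs'; rewrite -(subrKA (y (t + s))) (splitr e).
  rewrite (le_trans (ler_normD _ _))//; apply: lerD => //.
  by rewrite distrC.
have /compact_near_coveringP := @segment_compact R (- r) 0.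
move=> /(_ _ (nbhs t) (fun v s => `|y (t + s) - y (v + s)| <= e)).
move=> /(_ _ (fun s _ => yts s)); apply: filterS => v vP.
apply: hist_norm_le => [|s rs0]; first exact: ltW.
have -> : (segment r y t - segment r y v) s =
  segment r y t s - segment r y v s by [].
by rewrite !segment_contE//; exact: vP.
Qed.

(** The values of a solution before [-r] are arbitrary; freezing it at [y (- r)] there gives
    continuity on the whole line. *)
Lemma segment_extend y : {within `[- r, +oo[, continuous y} ->
  continuous (fun t => y (Num.max (- r) t)).
Proof.
move=> /subspace_continuousP cy t.
have mr u : `[- r, +oo[%classic (Num.max (- r) u).
  by rewrite /= in_itv/= andbT le_max lexx.
have := cy _ (mr t); apply: cvg_trans => U [e e0 eU].
have : \forall u \near t, ball (Num.max (- r) t) e (Num.max (- r) u).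
  have mc : {for t, continuous (fun u : R => Num.max (- r) u)}.
    by apply: continuous_max; [exact: cvg_cst|exact: cvg_id].
  exact: (mc _ (nbhsx_ballx _ _ e0)).
by apply: filterS => u /eU; apply; exact: mr.
Qed.

Lemma segment_extendE y t : 0 <= t ->
  segment r y t = segment r (fun t => y (Num.max (- r) t)) t.
Proof.
move=> t0; rewrite /segment; congr insubd; apply/funext => s.
case: ifPn => //; rewrite in_itv/= => /andP[rs _].
by rewrite max_r// (le_trans rs)// lerDr.
Qed.

Context (B : 'M[R]_m) (Bqp : quasipositive B).

(** The exponential inequality carries nonnegativity from [- r] to the whole interval. *)
Lemma exp_coneI phi : 0 <= r -> vle 0 (phi (- r)) ->
  (forall s t, - r <= s -> s <= t -> t <= 0 ->
    vle (expmx ((t - s) *: B) *m phi s) (phi t)) -> exp_cone B phi.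
Proof.
move=> r0 phi0 mono; split => // s; rewrite in_itv/= => /andP[rs s0] i.
apply: le_trans (mono _ _ (lexx _) rs s0 i).
by apply: expmx_vge0 => //; rewrite subr_ge0.
Qed.

Lemma exp_cone_gt0 phi : vlt 0 (phi (- r)) -> exp_cone B phi -> hist_lt 0 phi.
Proof.
move=> phi0 [_ mono] s; rewrite in_itv/= => /andP[rs s0] i.
apply: lt_le_trans (mono _ _ (lexx _) rs s0 i).
by apply: expmx_vgt0 => //; rewrite subr_ge0.
Qed.

Lemma exp_cone_intW phi : exp_cone_int B phi -> exp_cone B phi.
Proof.
move=> [lip [phi_gt0 [e e0 dphi]]].
split=> [s rs0 i|s t rs st t0]; first exact/ltW/phi_gt0.
have tr x : s <= x -> x <= t -> x \in `[- r, 0].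
  by move=> sx xt; rewrite in_itv/= (le_trans rs sx) (le_trans xt t0).
apply: (ae_expmx_le Bqp st).
  move=> j; have [M [Mr lipM]] := lip.
  (* [lipM] holds for every constant above [M], in particular [|M| + 1]; the term [hist_norm phi]
     bounds the values. *)
  pose K := `|M| + 1 + hist_norm phi.
  have K0 : 0 <= K by rewrite !addr_ge0// hist_norm_ge0.
  exists K => // x y sx xy yt; split.
    rewrite (le_trans (mx_coord_norm_le _ _ _))//.
    rewrite (le_trans (hist_norm_ub _ (tr _ sx (le_trans xy yt))))//.
    by rewrite lerDr addr_ge0.
  have -> : phi y j ord0 - phi x j ord0 = (phi y - phi x) j ord0 by rewrite !mxE.
  rewrite (le_trans (mx_coord_norm_le _ _ _))//.
  have M1 : M < `|M| + 1 by rewrite (le_lt_trans (ler_norm _))// ltrDl.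
  have := lipM _ M1 (y, x); rewrite /= => /(_ _)/le_trans; apply.
    by split; apply: tr => //; [exact: le_trans xy|exact: le_trans yt].
  rewrite (ger0_norm (x := y - x)) ?subr_ge0// ler_wpM2r ?subr_ge0//.
  by rewrite lerDl hist_norm_ge0.
have [N [mN N0 sN]] := dphi; exists N; split=> // x nP; apply: sN => /= {}D.
apply: nP => /=; rewrite in_itv/= => /andP[sx xt].
have [dx Dx] := D (tr _ sx xt); split => // i.
by apply: le_trans (Dx i); rewrite !mxE ltW.
Qed.

End history.

(** * Recurrence of minimal flows *)

Section recurrence.
Context {R : realType} {Omega : topologicalType} (flow : R -> Omega -> Omega).

Lemma flow_time_continuous (t : R) : continuous_flow flow -> continuous (flow t).
Proof.
move=> [cflow _ _] w.
apply: (@continuous_comp _ _ _ (fun w => (t, w)) (fun p => flow p.1 p.2)).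
  move=> A [[P Q] /= [tP wQ] PQA]; apply: filterS wQ => v Qv.
  by apply: (PQA (t, v)); split => //; exact: nbhs_singleton.
exact: cflow.
Qed.

(** The points whose orbit avoids [U] form a closed invariant set that misses [u]; by minimality it
    is empty. *)
Lemma minimal_flow_hits (U : set Omega) : continuous_flow flow ->
  minimal_flow flow -> open U -> U !=set0 -> forall w, exists t, U (flow t w).
Proof.
move=> cflow mflow oU [u Uu] w; apply: contrapT => /forallNP wU.
have [_ flow0 flowD] := cflow.
pose A := [set w | forall t, ~ U (flow t w)].
suff AT : A = setT by move/seteqP: AT => [_ /(_ u I)/(_ 0)]; rewrite flow0.
apply: mflow => [||t].
- have -> : A = ~` \bigcup_t (flow t @^-1` U).
    apply/seteqP; split=> [v Av [t _]|v nv t Ut]; first exact: Av.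
    by apply: nv; exists t.
  apply/open_closedC/bigcup_open => t _.
  by move/continuousP: (flow_time_continuous (t := t) cflow); exact.
- by exists w.
apply/seteqP; split=> [_ [v Av <-] s|v Av]; first by rewrite -flowD; exact: Av.
exists (flow (- t) v); last by rewrite -flowD subrr flow0.
by move=> s; rewrite -flowD; exact: Av.
Qed.

(** Hitting [U] at a given time is an open condition on [w], so compactness bounds the hitting
    times. They may be negative. *)
Lemma minimal_flow_recurrence (U : set Omega) : compact [set: Omega] ->
  continuous_flow flow -> minimal_flow flow -> open U -> U !=set0 ->
  exists2 T, 0 < T & forall w, exists2 t, `|t| <= T & U (flow t w).
Proof.
move=> cO cflow mflow oU U0.
have /compact_near_coveringP/(_ _ (pinfty_nbhs R)) := cO.
move=> /(_ (fun T w => exists2 t, `|t| <= T & U (flow t w))) cov.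
have : \forall T \near +oo,
    [set: Omega] `<=` (fun w => exists2 t, `|t| <= T & U (flow t w)).
  apply: cov => w _; have [t Ut] := minimal_flow_hits cflow mflow oU U0 w.
  exists (flow t @^-1` U, [set T | `|t| <= T]) => /=.
    split; last exact: nbhs_pinfty_ge.
    by apply: flow_time_continuous => //; exact: open_nbhs_nbhs.
  by move=> [v T] /= [Uv tT]; exists t.
move=> [M [Mr MT]]; exists (`|M| + 1); first by rewrite ltr_wpDl.
by move=> w; apply: MT => //; rewrite (le_lt_trans (ler_norm _))// ltrDl.
Qed.

End recurrence.

Lemma derive_lower_bound (R : realType) (f df : R -> R) (a b k : R) : a <= b ->
  {within `[a, b], continuous f} ->
  (forall x, a < x -> x < b -> is_derive x 1 f (df x)) ->
  (forall x, a < x -> x < b -> k <= df x) -> k * (b - a) <= f b - f a.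
Proof.
rewrite le_eqVlt => /predU1P[->|ab] cf fD dfk; first by rewrite !subrr mulr0.
have fD' x : x \in `]a, b[ -> is_derive x 1 f (df x).
  by rewrite in_itv/= => /andP[ax xb]; exact: fD.
have [x xab ->] := MVT ab fD' cf.
move: xab; rewrite in_itv/= => /andP[ax xb].
by rewrite ler_wpM2r ?subr_ge0 ?(ltW ab)//; exact: dfk.
Qed.

(** Half the value at [x] is a lower bound near [x]; compactness is applied along [e] tending to 0
    from the right, so no minimum has to be attained. *)
Lemma compact_pos_lower_bound (R : realType) (T : topologicalType) (n : nat)
    (f : T -> 'cV[R]_n) : compact [set: T] -> continuous f ->
  (forall x, vlt 0 (f x)) -> exists2 e, 0 < e & forall x i, e <= f x i ord0.
Proof.
move=> cT cf f0.
have /compact_near_coveringP/(_ _ ((0 : R)^'+)) := cT.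
move=> /(_ (fun e x => forall i, e <= f x i ord0)) cov.
have : \forall e \near 0^'+, [set: T] `<=` (fun x => forall i, e <= f x i ord0).
  apply: cov => x _.
  have fx i : \forall x' \near x & e \near 0^'+, e <= f x' i ord0.
    have fi0 : 0 < f x i ord0 by have := f0 x i; rewrite mxE.
    exists ([set x' | f x i ord0 / 2 < f x' i ord0], [set e | e <= f x i ord0 / 2]) => /=.
      split; last by apply: nbhs_right_le; rewrite divr_gt0.
      have ci : {for x, continuous (fun x => f x i ord0)}.
        exact: (cvg_comp _ _ (cf x) (@coord_continuous _ _ _ i ord0 (f x))).
      by apply: (cvgr_gt _ ci); lra.
    by move=> [x' e] /= [fx' ef]; exact: le_trans (ltW fx').
  exact: filter_forall fx.
move=> /(filterI (nbhs_right_gt 0)) /filter_ex[e [e0 ef]].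
by exists e => // x i; exact: ef.
Qed.

(** * Positive solutions *)

Section persistence.
Context {R : realType} {Omega : pseudoMetricType R} {r : R} {m : nat}.
Variables (flow : R -> Omega -> Omega) (B : 'M[R]_m).
Variable F : Omega -> hist r m -> 'cV[R]_m.
Hypotheses (r_gt0 : 0 < r) (cflow : continuous_flow flow).
Hypothesis Bqp : quasipositive B.
Hypothesis cF : continuous (fun p : Omega * hist r m => F p.1 p.2).
Hypothesis F_monotone : forall (w : Omega) (phi psi : hist r m),
  exp_le B phi psi -> hist_lt phi psi ->
  vlt (B *m (psi 0 - phi 0)) (F w psi - F w phi).
Hypothesis F_ge0 : forall w : Omega, vle 0 (F w 0).

(** * Invariance of the cone along a solution *)

Section solution.
Variables (w : Omega) (phi : hist r m) (y : R -> 'cV[R]_m).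
Hypotheses (sol : is_solution flow F w phi y) (phi_int : exp_cone_int B phi).

(* [y' - B y] for [t > 0], and continuous on [t >= 0]. *)
Let defect t := F (flow t w) (segment r y t) - B *m y t.

Let cy : {within `[- r, +oo[, continuous y}. Proof. by case: sol. Qed.

Lemma solution_within a b : - r <= a -> {within `[a, b], continuous y}.
Proof.
move=> ra; apply: continuous_subspaceW cy => t /=.
by rewrite !in_itv/= andbT => /andP[/(le_trans ra)].
Qed.

Lemma solution_defect_near t : 0 <= t -> vlt 0 (defect t) ->
  exists2 d, 0 < d & forall v, t <= v -> v < t + d -> vlt 0 (defect v).
Proof.
move=> t0 Gt.
pose Y u := y (Num.max (- r) u).
have cY : continuous Y by exact: segment_extend.
pose G u := F (flow u w) (segment r Y u) - B *m Y u.
have GE u : 0 <= u -> defect u = G u.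
  move=> u0; rewrite /defect /G segment_extendE// /Y max_r//.
  by rewrite (le_trans _ u0)// oppr_le0 ltW.
have cG : continuous G.
  move=> u; apply: cvgB.
    have cflow_u : (fun u => flow u w) @ u --> flow u w.
      have [cf _ _] := cflow.
      apply: (@continuous_comp _ _ _ (fun u : R => (u, w)) (fun p => flow p.1 p.2)).
        move=> A [[P Q] /= [uP wQ] PQA]; apply: filterS uP => v Pv.
        by apply: (PQA (v, w)); split => //; exact: nbhs_singleton.
      exact: cf.
    apply: (@cvg_comp _ _ _ (fun u => (flow u w, segment r Y u))
      (fun p => F p.1 p.2) _ (nbhs (flow u w, segment r Y u))); last first.
      exact: (@cF (flow u w, segment r Y u)).
    move=> A [[P Q] [/= fP sQ] PQA].
    have {}fP : \forall v \near u, P (flow v w) by exact: cflow_u.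
    have {}sQ : \forall v \near u, Q (segment r Y v) by exact: segment_continuous.
    apply: filterS2 fP sQ => v Pv Qv.
    by apply: (PQA (flow v w, segment r Y v)); split.
  apply: cvg_mx => i j; rewrite [X in _ --> X]mxE.
  rewrite (_ : (fun u => _) = (fun u => \sum_k B i k * Y u k j)).
    apply: cvg_big => [|k _]; first exact: add_continuous.
    apply: cvgM; first exact: cvg_cst.
    exact: (cvg_comp _ _ (cY u) (@coord_continuous _ _ _ k j (Y u))).
  by apply/funext => v; rewrite mxE.
have Gi i : \forall v \near t, 0 < G v i ord0.
  have ci : (fun v => G v i ord0) @ t --> G t i ord0.
    exact: (cvg_comp _ _ (cG t) (@coord_continuous _ _ _ i ord0 (G t))).
  by apply: (cvgr_gt _ ci); rewrite -GE//; have := Gt i; rewrite mxE.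
have : \forall v \near t, forall i, 0 < G v i ord0 by exact: filter_forall Gi.
move=> /nbhs_ballP[d /= d0 dG]; exists d => // v tv vd i.
rewrite GE ?(le_trans t0)// mxE; apply: dG.
by rewrite -ball_normE/= distrC ger0_norm ?subr_ge0// ltrBlDl.
Qed.

(** Before time 0 the inequality comes from the cone condition on [phi], after time 0 from the sign
    of the defect; across 0 the two are composed by the group law. *)
Lemma solution_expmx_le t : 0 <= t ->
  (forall u, 0 <= u -> u < t -> vle 0 (defect u)) ->
  forall u v, - r <= u -> u <= v -> v <= t ->
    vle (expmx ((v - u) *: B) *m y u) (y v).
Proof.
move=> t0 G0.
have [_ yphi _ ysol] := sol.
have neg u v : - r <= u -> u <= v -> v <= 0 -> vle (expmx ((v - u) *: B) *m y u) (y v).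
  move=> ru uv v0.
  rewrite !yphi ?in_itv/= ?ru ?(le_trans uv)// ?v0 ?(le_trans ru)//.
  by have [_] := exp_cone_intW Bqp phi_int; apply.
have pos u v : 0 <= u -> u <= v -> v <= t -> vle (expmx ((v - u) *: B) *m y u) (y v).
  move=> u0 uv vt.
  apply: (derive_expmx_le Bqp (df := fun t => F (flow t w) (segment r y t))) => //.
  - by apply: solution_within; rewrite (le_trans _ u0)// oppr_le0 ltW.
  - by move=> x ux xv; apply: ysol; exact: le_lt_trans ux.
  - by move=> x ux xv; apply: G0; [rewrite (le_trans u0) ?ltW|exact: lt_le_trans vt].
move=> u v ru uv vt.
have [v0|/ltW v0] := leP v 0; first exact: neg.
have [u0|/ltW u0] := leP 0 u; first exact: pos.
move=> i; apply: le_trans (pos 0 v (lexx _) v0 vt i).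
rewrite (_ : v - u = (v - 0) + (0 - u)); last by rewrite subr0 sub0r.
rewrite expmxD -mulmxA -subr_ge0.
have yu : vle 0 (y 0 - expmx ((0 - u) *: B) *m y u).
  by move=> j; have := neg u 0 ru u0 (lexx _) j; rewrite !mxE -subr_ge0.
have v00 : 0 <= v - 0 by rewrite subr0.
by have := expmx_vge0 Bqp v00 yu i; rewrite mulmxBr [leLHS]mxE [leRHS]mxE [X in _ + X]mxE.
Qed.

(* Real induction: if the defect is nonnegative on [0, t[ then [y_t] is in the
   cone and [>> 0], and comparing [F] at [y_t] and at [0] makes it positive at [t]. *)
Lemma solution_defect_gt t : 0 <= t -> vlt (F (flow t w) 0) (defect t).
Proof.
have [_ yphi _ ysol] := sol.
have [_ [phi_gt0 _]] := phi_int.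
have step s : 0 <= s -> (forall u, 0 <= u -> u < s -> vle 0 (defect u)) ->
    vlt (F (flow s w) 0) (defect s).
  move=> s0 G0; have mono := solution_expmx_le s0 G0.
  have ypos u : - r <= u -> u <= s -> vlt 0 (y u).
    move=> ru us; have [u0|/ltW u0] := leP u 0.
      by rewrite yphi; [apply: phi_gt0|]; rewrite in_itv/= ru.
    move=> i; apply: lt_le_trans (mono 0 u _ u0 us i); last by rewrite oppr_le0 ltW.
    rewrite subr0; apply: expmx_vgt0 => //.
    by rewrite yphi; [apply: phi_gt0|]; rewrite in_itv/= lexx oppr_le0 ltW.
  have sE x : x \in `[- r, 0] -> segment r y s x = y (s + x).
    by move=> xr; exact: segmentE.
  have rs0 : - r \in `[- r, 0] by rewrite in_itv/= lexx oppr_le0 ltW.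
  have s00 : 0 \in `[- r, 0] by rewrite in_itv/= lexx oppr_le0 ltW.
  have seg_gt0 : hist_lt 0 (segment r y s).
    move=> x xr; rewrite sE//; move: xr; rewrite in_itv/= => /andP[rx x0].
    apply: ypos; last by rewrite gerDl.
    by rewrite (le_trans rx)// lerDr.
  have seg_cone : exp_le B 0 (segment r y s).
    rewrite /exp_le subr0; apply: exp_coneI => //; first exact: ltW.
      by move=> i; apply/ltW/seg_gt0.
    move=> x x' rx xx' x'0.
    rewrite !sE ?in_itv/= ?rx ?x'0 ?(le_trans xx')// ?(le_trans rx)//.
    have -> : x' - x = (s + x') - (s + x) by ring.
    apply: mono; rewrite ?lerD2l ?gerDl//.
    by rewrite (le_trans rx)// lerDr.
  move=> i; have := F_monotone (flow s w) seg_cone seg_gt0 i.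
  rewrite /defect sE// addr0 [(0 : hist r m) 0](_ : _ = 0)// subr0 !mxE.
  by move=> ?; lra.
have pos s : 0 <= s -> vlt 0 (defect s).
  move: s; apply: real_induction => s s0 G0.
  apply: solution_defect_near => // i.
  apply: le_lt_trans (F_ge0 (flow s w) i) _; apply: step => // u u0 us j.
  exact/ltW/G0.
by move=> t0; apply: step => // u u0 _ i; exact/ltW/pos.
Qed.

Lemma solution_mono u v : - r <= u -> u <= v ->
  vle (expmx ((v - u) *: B) *m y u) (y v).
Proof.
move=> ru uv; have [v0|/ltW v0] := leP v 0.
  (* At time 0 the sign condition on the defect is vacuous. *)
  apply: (@solution_expmx_le 0) => //.
  by move=> s s0 /(le_lt_trans s0); rewrite ltxx.
apply: (@solution_expmx_le v) => // s s0 _ i.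
by apply: le_trans (F_ge0 (flow s w) i) _; exact/ltW/solution_defect_gt.
Qed.

Lemma solution_gt0 t : - r <= t -> vlt 0 (y t).
Proof.
have [_ yphi _ _] := sol; have [_ [phi_gt0 _]] := phi_int.
move=> rt i; apply: lt_le_trans (solution_mono (lexx _) rt i).
apply: expmx_vgt0 => //; first by rewrite subr_ge0.
by rewrite yphi; [apply: phi_gt0|]; rewrite in_itv/= lexx oppr_le0 ltW.
Qed.

End solution.

(** * Eventual uniform lower bound on the components *)

Section lower_bound.
Variable k : R.
Hypothesis kB : forall i, - k <= B i i.

(* [k >= - B i i] makes [e^(ku) y_i(u)] nondecreasing for positive solutions. *)
Let h (y : R -> 'cV[R]_m) i u := expR (k * u) * y u i ord0.

Let dh w y i u :=
  expR (k * u) * (F (flow u w) (segment r y u) i ord0 + k * y u i ord0).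

Lemma solution_damped_derive w phi y i (u : R) : is_solution flow F w phi y -> 0 < u ->
  is_derive u 1 (h y i) (dh w y i u).
Proof.
move=> [_ _ _ ysol] u0.
have yD := is_derive_mx_coord (ysol u u0) i ord0.
have eD : is_derive u 1 (fun u => expR (k * u + 0)) (k * expR (k * u + 0)).
  exact: is_derive_affine.
rewrite (_ : h y i = (fun u => expR (k * u + 0)) * (fun u => y u i ord0)).
  by apply: is_derive_eq; rewrite /dh addr0 /GRing.scale/=; ring.
by apply/funext => v; rewrite fctE addr0.
Qed.

(** [solution_defect_gt] gives [F_i(w.u, y_u) > F_i(w.u, 0) + (B y)_i]. The off-diagonal part of
    [(B y)_i] is nonnegative and the diagonal part is at least [- k y_i]. *)
Lemma solution_damped_ge w phi y i (u : R) : is_solution flow F w phi y ->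
  exp_cone_int B phi -> 0 <= u -> expR (k * u) * F (flow u w) 0 i ord0 <= dh w y i u.
Proof.
move=> sol phi_int u0; rewrite ler_wpM2l ?expR_ge0//.
have := solution_defect_gt sol phi_int u0 i; rewrite mxE [X in _ + X]mxE => /ltW.
move=> /le_trans; apply; rewrite lerD2l mxE (bigD1 i)//= opprD.
have ru : - r <= u by rewrite (le_trans _ u0)// oppr_le0 ltW.
have y0 j : 0 <= y u j ord0.
  by have := solution_gt0 sol phi_int ru j; rewrite mxE => /ltW.
have := ler_wpM2r (y0 i) (kB i).
suff : 0 <= \sum_(j < m | j != i) B i j * y u j ord0 by lra.
by apply: sumr_ge0 => j ji; rewrite mulr_ge0// Bqp// eq_sym.
Qed.

Lemma solution_damped_within w phi y i a b : is_solution flow F w phi y -> - r <= a ->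
  {within `[a, b], continuous (h y i)}.
Proof.
move=> sol ra t; have cy : {within `[a, b], continuous y}.
  by have := solution_within sol ra; apply.
apply: cvgM.
  apply: (is_derive_within_continuous (f := fun u => expR (k * u))
    (df := fun u => k * expR (k * u))) => u.
  have := is_derive_affine (c := 0) (s := k) (t := u) (is_derive_expR _).
  by under eq_fun do rewrite addr0; rewrite addr0.
exact: (cvg_comp _ _ (cy t) (@coord_continuous _ _ _ i ord0 (y t))).
Qed.

(** [e^(ku) y_i] gains at least [e^(ka) e (b - a)] on [[a, b]] and does not decrease afterwards.
    Strictness comes from its positive value at [a]. *)
Lemma solution_window w phi y i a b e t : is_solution flow F w phi y ->
  exp_cone_int B phi -> 0 <= k -> 0 <= e -> 0 <= a -> a <= b -> b <= t ->
  (forall u, a < u -> u < b -> e <= F (flow u w) 0 i ord0) ->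
  e * (b - a) * expR (- k * (t - a)) < y t i ord0.
Proof.
move=> sol phi_int k0 e0 a0 ab bt Fe.
have ra : - r <= a by rewrite (le_trans _ a0)// oppr_le0 ltW.
have rb := le_trans ra ab; have b0 := le_trans a0 ab.
have H1 : expR (k * a) * e * (b - a) <= h y i b - h y i a.
  apply: (derive_lower_bound (df := dh w y i) ab).
  - exact: solution_damped_within sol ra.
  - by move=> x ax xb; apply: solution_damped_derive sol _; exact: le_lt_trans ax.
  - move=> x ax xb; have x0 := le_trans a0 (ltW ax).
    apply: le_trans (solution_damped_ge i sol phi_int x0).
    apply: ler_pM; rewrite ?expR_ge0 ?ler_expR ?Fe//.
    by rewrite ler_wpM2l// ltW.
have H2 : 0 * (t - b) <= h y i t - h y i b.
  apply: (derive_lower_bound (df := dh w y i) bt).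
  - exact: solution_damped_within sol rb.
  - by move=> x bx xt; apply: solution_damped_derive sol _; exact: le_lt_trans bx.
  - move=> x bx xt; have x0 := le_trans b0 (ltW bx).
    apply: le_trans (solution_damped_ge i sol phi_int x0).
    by rewrite mulr_ge0 ?expR_ge0//; have := F_ge0 (flow x w) i; rewrite mxE.
have ha : 0 < h y i a.
  by rewrite mulr_gt0 ?expR_gt0//; have := solution_gt0 sol phi_int ra i; rewrite mxE.
rewrite -(ltr_pM2l (expR_gt0 (k * t))) -/(h y i t).
rewrite (_ : _ * (_ * _) = expR (k * a) * e * (b - a)); first by lra.
rewrite mulrCA -expRD (_ : k * t + _ = k * a); last by ring.
by ring.
Qed.

End lower_bound.

Lemma solution_eventually_ge : compact [set: Omega] -> minimal_flow flow ->
  (exists w, vlt 0 (F w 0)) ->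
  exists T c, [/\ 0 < T, 0 < c & forall w phi y, is_solution flow F w phi y ->
    exp_cone_int B phi -> forall t, T <= t -> forall i, c < y t i ord0].
Proof.
move=> cO mflow [w0 Fw0].
have [cfl flow0 flowD] := cflow.
have [e [e0 eF]] : exists e, 0 < e /\ forall i, e < F w0 0 i ord0.
  have ev : \forall e \near 0^'+, forall i, e < F w0 0 i ord0.
    have evi i : \forall e \near 0^'+, e < F w0 0 i ord0.
      by apply: nbhs_right_lt; have := Fw0 i; rewrite mxE.
    exact: filter_forall evi.
  by have [e [? ?]] := filter_ex (filterI (nbhs_right_gt 0) ev); exists e.
have cF0 : continuous (fun w => F w 0).
  move=> w A FA; have [[P Q] /= [wP Q0] PQA] := @cF (w, 0) A FA.
  apply: filterS wP => v Pv; apply: (PQA (v, 0)); split => //.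
  exact: nbhs_singleton.
(* Joint continuity at [(0, w0)] yields a box: an orbit that enters [Q] keeps [F(., 0)] above [e]
   for a time [d]. *)
have near0 : \forall p \near (0 : R, w0), forall i, e < F (flow p.1 p.2) 0 i ord0.
  have near0i i : \forall p \near (0 : R, w0), e < F (flow p.1 p.2) 0 i ord0.
    have c0 : (fun p : R * Omega => F (flow p.1 p.2) 0) @ (0 : R, w0) --> F (flow 0 w0) 0.
      exact: (cvg_comp _ _ (cfl (0, w0)) (cF0 _)).
    have ci := cvg_comp _ _ c0 (@coord_continuous _ _ _ i ord0 _).
    by apply: (cvgr_gt _ ci); rewrite /= flow0.
  exact: filter_forall near0i.
case: near0 => -[P Q] /= [/nbhs_ballP[d /= d0 dP] Qw0] PQ.
have [T0 T00 T0P] : exists2 T, 0 < T &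
    forall w, exists2 t, `|t| <= T & Q° (flow t w).
  apply: minimal_flow_recurrence => //; first exact: open_interior.
  by exists w0; exact: Qw0.
pose k := \sum_i `|B i i|.
have kB i : - k <= B i i.
  rewrite lerNl (le_trans (ler_norm _))// normrN /k (bigD1 i)//= lerDl.
  exact: sumr_ge0.
have k0 : 0 <= k by exact: sumr_ge0.
(* [c] is the gain [e * d] of one window, damped over the longest possible delay [2 * T0 + d] since
   its start. *)
exists (2 * T0 + d), (e * d * expR (- k * (2 * T0 + d))).
split; first by rewrite addr_gt0 ?mulr_gt0.
  by rewrite !mulr_gt0 ?expR_gt0.
move=> w phi y sol phi_int t Tt i.
(* Since [|s| <= T0], this base time puts the start [a] of the window in [[t - 2 T0 - d, t - d]]:
   after time 0, and early enough to end by [t]. *)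
have [s sT0 Qs] := T0P (flow (t - T0 - d) w).
pose a := s + (t - T0 - d).
move: sT0; rewrite ler_norml => /andP[s1 s2].
have a0 : 0 <= a by rewrite /a; lra.
have adt : a + d <= t by rewrite /a; lra.
have window u : a < u -> u < a + d -> e <= F (flow u w) 0 i ord0.
  move=> au ud; rewrite (_ : u = (u - a) + s + (t - T0 - d)); last by rewrite /a; ring.
  have Pu : P (u - a) by apply: dP; rewrite -ball_normE/= sub0r normrN ger0_norm; lra.
  have := PQ (u - a, flow s (flow (t - T0 - d) w)) (conj Pu (interior_subset Qs)) i.
  by rewrite /= -!flowD => /ltW.
have := solution_window kB sol phi_int k0 (ltW e0) a0 _ adt window.
rewrite lerDl (ltW d0) => /(_ isT); apply: le_lt_trans.
rewrite addrAC subrr add0r ler_pM2l ?mulr_gt0// ler_expR !mulNr lerN2.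
by rewrite ler_wpM2l// /a; lra.
Qed.

(** * Uniform lower bound on the defect *)

Section comparison.
Variable c : R.
Hypothesis c0 : 0 < c.

(* [chi(s) = e^((s + r)B) c] satisfies [chi' = B chi], so [chi <=_B y_t] only
   requires [c <= y(t - r)]. *)
Let flat : hist r m :=
  segment r (fun s => expmx ((s + r) *: B) *m const_mx c) 0.

Let flatE s : s \in `[- r, 0] -> flat s = expmx ((s + r) *: B) *m const_mx c.
Proof.
move=> sr; rewrite /flat segment_contE//; first by rewrite add0r.
move=> t; apply: cvg_mx => i j.
rewrite (_ : (fun u => _) =
    (fun u => \sum_k expmx ((1 * u + r) *: B) i k * (const_mx c : 'cV[R]_m) k j)).
  rewrite mxE; apply: cvg_big => [|k _]; first exact: add_continuous.
  apply: cvgM; last exact: cvg_cst.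
  have [/derivable1_diffP/differentiable_continuous ct _] :=
    is_derive_expmx_affine B r 1 t i k.
  rewrite [X in _ --> X](_ : _ = expmx ((1 * t + r) *: B) i k); last by rewrite mul1r.
  exact: ct.
by apply/funext => u; rewrite mxE mul1r.
Qed.

(** In the cone inequality for [y_t - flat] the contributions of [flat] cancel by the group law,
    which leaves [solution_mono]. *)
Let flat_sub w phi y t : is_solution flow F w phi y -> exp_cone_int B phi ->
  0 <= t -> (forall i, c < y (t - r) i ord0) ->
  exp_le B flat (segment r y t) /\ hist_lt flat (segment r y t).
Proof.
move=> sol phi_int t0 yc.
have cy : {within `[- r, +oo[, continuous y} by case: sol.
have diffE s : s \in `[- r, 0] -> (segment r y t - flat) s =
    y (t + s) - expmx ((s + r) *: B) *m const_mx c.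
  by move=> sr; rewrite -flatE// -(segmentE cy t0 sr).
have rr : - r \in `[- r, 0] by rewrite in_itv/= lexx oppr_le0 ltW.
have diff_r : vlt 0 ((segment r y t - flat) (- r)).
  by move=> i; rewrite diffE// addNr expmx0 mul1mx !mxE subr_gt0.
have cone : exp_le B flat (segment r y t).
  apply: exp_coneI => //; first exact: ltW.
    by move=> i; exact/ltW/diff_r.
  move=> s s' rs ss' s'0.
  rewrite !diffE ?in_itv/= ?rs ?s'0 ?(le_trans rs)// ?(le_trans ss')//.
  rewrite mulmxBr mulmxA -expmxD addrA subrK => i.
  have rts : - r <= t + s by rewrite (le_trans rs)// lerDr.
  have := solution_mono sol phi_int rts (_ : t + s <= t + s').
  rewrite lerD2l => /(_ ss' i); rewrite (_ : t + s' - (t + s) = s' - s); last by ring.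
  by move=> ytt; rewrite [leLHS]mxE [leRHS]mxE lerD2r.
split => // s sr i; have := exp_cone_gt0 Bqp diff_r cone sr i.
rewrite [(0 : hist r m) s](_ : _ = 0)// mxE.
rewrite [X in _ < X -> _](_ : _ = (segment r y t s - flat s) i ord0)//.
by rewrite mxE [X in _ + X]mxE subr_gt0.
Qed.

(** Monotonicity between [flat] and [y_t] bounds the defect below by [F(w.t, flat) - B flat(0)];
    monotonicity between 0 and [flat] makes this positive, and compactness makes it uniform. *)
Lemma solution_defect_lower_bound : compact [set: Omega] ->
  exists2 e, 0 < e & forall w phi y, is_solution flow F w phi y ->
    exp_cone_int B phi -> forall t, 0 <= t -> (forall i, c < y (t - r) i ord0) ->
    forall i, e <= (F (flow t w) (segment r y t) - B *m y t) i ord0.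
Proof.
move=> cO.
have rr : - r \in `[- r, 0] by rewrite in_itv/= lexx oppr_le0 ltW.
have r0 : 0 \in `[- r, 0] by rewrite in_itv/= lexx oppr_le0 ltW.
have flat_r : vlt 0 (flat (- r)).
  by move=> i; rewrite flatE// addNr expmx0 mul1mx !mxE.
have flat_cone : exp_cone B flat.
  apply: exp_coneI => //; first exact: ltW.
    by move=> i; exact/ltW/flat_r.
  move=> s t rs st t0 i.
  rewrite !flatE ?in_itv/= ?rs ?t0 ?(le_trans rs)// ?(le_trans st)//.
  by rewrite mulmxA -expmxD addrA subrK.
have flat_gt0 := exp_cone_gt0 Bqp flat_r flat_cone.
have [e e0 eP] : exists2 e, 0 < e &
    forall w i, e <= (F w flat - B *m flat 0) i ord0.
  apply: compact_pos_lower_bound => // [w|w i].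
    apply: cvgB; last exact: cvg_cst.
    move=> A FA; have [[P Q] /= [wP Qflat] PQA] := @cF (w, flat) A FA.
    apply: filterS wP => v Pv; apply: (PQA (v, flat)); split => //.
    exact: nbhs_singleton.
  have flat_le : exp_le B 0 flat by rewrite /exp_le subr0.
  have := F_monotone w flat_le flat_gt0 i; have := F_ge0 w i.
  rewrite [(0 : hist r m) 0](_ : _ = 0)// subr0 !mxE.
  by move=> ? ?; lra.
exists e => // w phi y sol phi_int t t0 yc i.
have [le_flat lt_flat] := flat_sub sol phi_int t0 yc.
apply: le_trans (eP (flow t w) i) _.
have := F_monotone (flow t w) le_flat lt_flat i.
have cy : {within `[- r, +oo[, continuous y} by case: sol.
rewrite (segmentE cy t0 r0) addr0 mulmxBr !mxE => ?.
lra.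
Qed.

End comparison.

(** * The lower bound [psi] of the persistence statement *)

Section exponential_history.
Variables a k : R.
Hypotheses (a0 : 0 < a) (k0 : 0 <= k) (k_ge : forall i, 1 <= k - \sum_j B i j).

(** All components are equal, so [B] acts through its row sums, which [k] exceeds by at least 1. *)
Let e_vec s : 'cV[R]_m := const_mx (a * expR (k * s)).

(** The shift [s] allows comparison with a solution in absolute time; [s = 0] gives the history
    itself. *)
Let is_derive_e_vec (s t : R) :
  is_derive t 1 (fun u => e_vec (u - s)) (k *: e_vec (t - s)).
Proof.
apply: is_derive_mxP => i j.
have eD : is_derive t 1 (fun u => expR (k * u + - (k * s)))
    (k * expR (k * t + - (k * s))).
  exact: is_derive_affine.
rewrite (_ : (fun u => _) = a *: (fun u => expR (k * u + - (k * s)))).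
  apply: is_derive_eq; rewrite !mxE /GRing.scale/= mulrBr; ring.
by apply/funext => u; rewrite mxE mulrBr.
Qed.

Let e_vec_continuous : continuous e_vec.
Proof.
move=> t; have [/derivable1_diffP/differentiable_continuous + _] := is_derive_e_vec 0 t.
rewrite (_ : (fun u => _) = e_vec)//; apply/funext => u.
by rewrite subr0.
Qed.

Definition exp_hist : hist r m := segment r e_vec 0.

Let exp_histE s : s \in `[- r, 0] -> exp_hist s = e_vec s.
Proof. by move=> sr; rewrite /exp_hist segment_contE// add0r. Qed.

Let e_vec_defect s i : (k *: e_vec s - B *m e_vec s) i ord0 =
  a * expR (k * s) * (k - \sum_j B i j).
Proof.
rewrite !mxE mulrBr; congr (_ - _); first by rewrite mulrC.
by rewrite mulr_sumr; apply: eq_bigr => j _; rewrite mxE mulrC.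
Qed.

Lemma exp_hist_int : exp_cone_int B exp_hist.
Proof.
split; last split.
- have [K K0 KP] : lip_bounded (- r) 0 (fun s => a * expR (k * s)).
    have e_vecD (s : R) : is_derive s 1 (fun s => a * expR (k * s))
        (a * k * expR (k * s)).
      have eD : is_derive s 1 (fun u => expR (k * u + 0)) (k * expR (k * s + 0)).
        exact: is_derive_affine.
      rewrite (_ : (fun u => _) = a *: (fun u => expR (k * u + 0))).
        by apply: is_derive_eq; rewrite addr0 /GRing.scale/=; ring.
      by apply/funext => u; rewrite fctE addr0.
    apply: (is_derive_lip_bounded _ e_vecD); first by rewrite oppr_le0 ltW.
    apply: (is_derive_within_continuous (df := fun s => k * (a * k * expR (k * s)))) => s.
    rewrite (_ : (fun u => _) = k *: (fun s => a * expR (k * s))).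
      by apply: is_derive_eq; rewrite /GRing.scale/=.
    by apply/funext => u; rewrite fctE /GRing.scale/=; ring.
  have lip x y : x \in `[- r, 0] -> y \in `[- r, 0] -> x <= y ->
      `|exp_hist y - exp_hist x| <= K * (y - x).
    rewrite !in_itv/= => /andP[rx x0] /andP[ry y0] xy.
    rewrite !exp_histE ?in_itv/= ?rx ?ry//.
    apply: mx_norm_le => [|i j]; first by rewrite mulr_ge0 ?subr_ge0.
    by rewrite !mxE; have [] := KP x y rx xy y0.
  (* The Lipschitz predicate asks for every constant above some real, and for pairs in either
     order. *)
  exists K; split; first exact: num_real.
  move=> M KM [x y] /= [xr yr].
  have KM' z : 0 <= z -> K * z <= M * z by move=> z0; rewrite ler_wpM2r// ltW.
  have [xy|/ltW xy] := leP x y.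
    rewrite distrC (le_trans (lip _ _ xr yr xy))// distrC ger0_norm ?subr_ge0//.
    by rewrite KM' ?subr_ge0.
  rewrite (le_trans (lip _ _ yr xr xy))// ger0_norm ?subr_ge0//.
  by rewrite KM' ?subr_ge0.
- move=> s sr i; rewrite [(0 : hist r m) s](_ : _ = 0)// exp_histE// !mxE.
  by rewrite mulr_gt0 ?expR_gt0.
(* This is the value of [a e^(ks)] at [s = - r], its least on [[-r, 0]]; the factor
   [k - \sum_j B i j] is at least 1. *)
exists (a * expR (- (k * r))); first by rewrite mulr_gt0 ?expR_gt0.
(* Only the endpoints are discarded, where the extension by 0 jumps. *)
exists [set - r; 0]; split.
- by apply: measurableU; exact: measurable_set1.
- apply: countable_lebesgue_measure0; exact: finite_set_countable.
move=> t nP; apply: contrapT => /not_orP[/eqP tr /eqP t0]; apply: nP => tr0.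
have tin : t \in `]- r, 0[.
  move: tr0; rewrite !in_itv/= => /andP[rt t0'].
  by rewrite !lt_neqAle rt t0' eq_sym tr t0.
have D : is_derive t 1 (exp_hist : R -> 'cV[R]_m) (k *: e_vec t).
  have := is_derive_e_vec 0 t; rewrite subr0; apply: near_eq_is_derive.
  have := near_in_itvoo tin; apply: filterS => u.
  rewrite in_itv/= => /andP[ru u0].
  by rewrite exp_histE ?subr0// in_itv/= !ltW.
case: D => dD ->; split => // i; rewrite exp_histE//.
rewrite e_vec_defect mxE.
move: tin; rewrite in_itv/= => /andP[rt _].
apply: (@le_trans _ _ (a * expR (k * t))).
  by rewrite ler_pM2l// ler_expR -mulrN ler_wpM2l// ltW.
by rewrite ler_peMr// mulr_ge0 ?expR_ge0// ltW.
Qed.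

(** The difference of [y] and the shifted exponential is positive at [t - r]. Its defect on
    [[t - r, t]] is at least [e - a (k - \sum_j B i j) >= 0], because [e^(k(u - t)) <= 1] there. *)
Lemma exp_hist_le w phi y t c e : is_solution flow F w phi y ->
  r <= t -> a <= c ->
  (forall i, a * (k - \sum_j B i j) <= e) ->
  (forall i, c < y (t - r) i ord0) ->
  (forall u, t - r <= u -> forall i,
    e <= (F (flow u w) (segment r y u) - B *m y u) i ord0) ->
  exp_le B exp_hist (segment r y t).
Proof.
move=> sol rt ac ae yc ye.
have t0 : 0 <= t by rewrite (le_trans _ rt)// ltW.
have [cy _ _ yD] := sol.
pose z u := y u - e_vec (u - t).
have diffE s : s \in `[- r, 0] -> (segment r y t - exp_hist) s = z (t + s).
  move=> sr; rewrite /z -(segmentE cy t0 sr) -exp_histE; last by rewrite addrAC subrr add0r.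
  by congr (_ - exp_hist _); rewrite addrAC subrr add0r.
have expR_le1 s : s <= 0 -> expR (k * s) <= 1.
  by move=> s0; rewrite -expR0 ler_expR mulr_ge0_le0.
apply: exp_coneI => //; first exact: ltW.
  move=> i; rewrite diffE ?in_itv/= ?lexx ?oppr_le0 ?ltW// /z !mxE.
  rewrite subr_gt0 (le_lt_trans _ (yc i))// (le_trans _ ac)//.
  by rewrite addrAC subrr add0r ler_piMr ?expR_le1 ?oppr_le0// ltW.
move=> s s' rs ss' s'0.
rewrite !diffE ?in_itv/= ?rs ?s'0 ?(le_trans rs)// ?(le_trans ss')//.
rewrite (_ : s' - s = (t + s') - (t + s)); last by ring.
have ts0 : 0 <= t + s by rewrite -lerBlDl sub0r (le_trans _ rs)// lerN2.
apply: (derive_expmx_le Bqp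
  (df := fun u => F (flow u w) (segment r y u) - k *: e_vec (u - t))).
- by rewrite lerD2l.
- have cy' : {within `[t + s, t + s'], continuous y}.
    by have := solution_within sol; apply; rewrite (le_trans _ ts0)// oppr_le0 ltW.
  have ce : {within `[t + s, t + s'], continuous (fun u => e_vec (u - t))}.
    apply: continuous_subspaceT => u.
    by apply/differentiable_continuous/derivable1_diffP; case: (is_derive_e_vec t u).
  by move=> u; apply: cvgB; [exact: cy'|exact: ce].
- move=> u ut us; have u0 := le_lt_trans ts0 ut.
  by have := yD u u0; have := is_derive_e_vec t u => ? ?; exact: is_deriveB.
- move=> u ut us i.
  have tru : t - r <= u by rewrite (le_trans _ (ltW ut))// lerD2l.
  have ut0 : u - t <= 0 by rewrite subr_le0 (le_trans (ltW us))// gerDl.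
  rewrite [leRHS](_ : _ = (F (flow u w) (segment r y u) - B *m y u) i ord0 -
      (k *: e_vec (u - t) - B *m e_vec (u - t)) i ord0); last first.
    by rewrite /z !mulmxBr !mxE; ring.
  rewrite e_vec_defect mxE subr_ge0 (le_trans _ (ye u tru i))//.
  rewrite (le_trans _ (ae i))// mulrAC ler_piMr ?expR_le1//.
  by rewrite mulr_ge0 ?(ltW a0)// (le_trans _ (k_ge i)).
Qed.

End exponential_history.

End persistence.

Theorem proposition2p7 (R : realType) (Omega : metricType R)
  (Omega_compact : compact [set: Omega])
  (flow : R -> Omega -> Omega)
  (flow_continuous : continuous_flow flow)
  (flow_minimal : minimal_flow flow)
  (r : R) (r_gt0 : 0 < r) (m : nat) (m_gt0 : (1 <= m)%N)
  (B : 'M[R]_m) (B_quasipositive : quasipositive B)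
  (F : Omega -> hist r m -> 'cV[R]_m)
  (tau_global : globally_defined flow F)
  (F_continuous : continuous (fun p : Omega * hist r m => F p.1 p.2))
  (F_C1 : C1_snd F)
  (F_bounded : forall X1 : set (hist r m), bounded_set X1 ->
    bounded_set [set F w phi | w in [set: Omega] & phi in X1])
  (F_monotone : forall (w : Omega) (phi psi : hist r m),
    exp_le B phi psi -> hist_lt phi psi ->
    vlt (B *m (psi 0 - phi 0)) (F w psi - F w phi))
  (F_ge0 : forall w : Omega, vle 0 (F w 0))
  (F_gt0 : exists w0 : Omega, vlt 0 (F w0 0)) :
  uniformly_persistent B (skew_product flow F).
Proof.
have [T [c [T0 c0 yc]]] := solution_eventually_ge r_gt0 flow_continuous
  B_quasipositive F_continuous F_monotone F_ge0 Omega_compact flow_minimal F_gt0.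
have [e e0 ye] := solution_defect_lower_bound r_gt0 flow_continuous
  B_quasipositive F_continuous F_monotone F_ge0 c0 Omega_compact.
(* [S] bounds every row sum in absolute value, so [k - \sum_j B i j] lies between 1 and [2 * k]. *)
pose S := \sum_i \sum_j `|B i j|; pose k := 1 + S.
have S0 : 0 <= S by apply: sumr_ge0 => i _; exact: sumr_ge0.
have BS i : `|\sum_j B i j| <= S.
  rewrite (le_trans (ler_norm_sum _ _ _))// /S [leRHS](bigD1 i)//= lerDl.
  by apply: sumr_ge0 => j _; exact: sumr_ge0.
have k0 : 0 < k by rewrite ltr_pwDl.
(* [a <= c] handles the left endpoint of the history, and [a * (2 * k) <= e] the defect. *)
pose a := Num.min c (e / (2 * k)).
have a0 : 0 < a by rewrite lt_min c0 divr_gt0 ?mulr_gt0.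
have k_ge i : 1 <= k - \sum_j B i j.
  by rewrite /k; move: (BS i); rewrite ler_norml => /andP[_ ?]; lra.
have ae i : a * (k - \sum_j B i j) <= e.
  apply: (@le_trans _ _ (e / (2 * k) * (2 * k))).
    apply: ler_pM; [exact: ltW|exact: le_trans (k_ge i)| |].
      by rewrite /a ge_min lexx orbT.
    by move: (BS i); rewrite ler_norml /k => /andP[? _]; lra.
  by rewrite divfK// gt_eqF// mulr_gt0.
exists (exp_hist a k); first by apply: exp_hist_int; rewrite ?ltW.
(* The defect is needed on [[t - r, t]], and its bound at [u] uses [y (u - r)]; the bound [c] must
   therefore hold from [t - 2 * r] on. *)
move=> w phi phi_int; exists (T + 2 * r).
  by rewrite addr_ge0 ?mulr_ge0 ?ltW.
(* Global existence ensures that the function picked by [xget] is a solution rather than the default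
   value. *)
move=> t tT; have sol : is_solution flow F w phi (solution flow F w phi).
  exact: xgetPex (tau_global w phi).
apply: (exp_hist_le (c := c) (e := e) r_gt0 B_quasipositive
  a0 (ltW k0) k_ge sol).
- lra.
- by rewrite /a ge_min lexx.
- exact: ae.
- by apply: (yc _ _ _ sol phi_int); lra.
- move=> u ut i; apply: (ye _ _ _ sol phi_int) => [|j]; first lra.
  by apply: (yc _ _ _ sol phi_int); lra.
Qed.
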